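(* Let $H$ be a finite simple graph with $\Delta(H)\le 2$, and let $G$ be obtained from $H$ by gluing in vertex-disjoint copies of $K_4$, i.e. there are pairwise disjoint $4$-element subsets $Y_1,\dots,Y_q\subseteq V(H)$ and $G$ has vertex set $V(H)$ and edge set $E(H)\cup\{uv: u\neq v,\ u,v\in Y_j \text{ for some } j\}$. Then there is a set of vertices $Z\subseteq V(G)$ with $|Z|\le |V(G)|/22$ such that $\chi(G-Z)\le 4$.
   Context: All graphs are finite and simple. *)

(* Defs.v *)
From mathcomp Require Import all_boot.
Set Implicit Arguments. Unset Strict Implicit. Unset Printing Implicit Defensive.

Definition simple_graph (T : finType) (e : rel T) : Prop :=
  irreflexive e /\ symmetric e.

Definition max_deg_le (T : finType) (e : rel T) (d : nat) : Prop :=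
  forall x : T, #|[set y | e x y]| <= d.

Definition glue_cliques (T : finType) (e : rel T) (q : nat)
  (Y : 'I_q -> {set T}) : rel T :=
  fun x y => e x y || ((x != y) && [exists j, (x \in Y j) && (y \in Y j)]).

Definition colorable_on (T : finType) (e : rel T) (A : {set T}) (k : nat) : Prop :=
  exists c : T -> 'I_k,
    forall x y, x \in A -> y \in A -> e x y -> c x != c y.

(* Main.v *)
Require Import Defs.
From mathcomp Require Import all_boot all_fingroup all_algebra all_field.
From mathcomp Require Import zify.
Set Implicit Arguments. Unset Strict Implicit. Unset Printing Implicit Defensive.
Import GRing.Theory.

(** A vertex outside the four-sets has degree at most two, hence is coloured
    last; and a graph of maximum degree two lies in the graph of a permutation
    [s].  So let [G] be the union of the cycles of [s] and of disjoint K4's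
    covering all vertices, let [t] be the number of triangles of [s] and [a]
    the total length of its odd cycles of length at least 5, so that
    [a + 3 t <= n].  Two sets [Z] are found, with [4 |Z| <= t] and with
    [10 |Z| <= a]; one of them has at most [n / 22] elements.

    First set: by Haxell's theorem some [s]-independent set [I] meets every K4
    exactly once.  An exchange argument makes it miss at most [t / 4] of the
    cycles of length at least 3; delete a vertex from each of those.  Then the
    vertices outside [I] span paths plus disjoint triangles, which are
    3-colourable by a variant of the cycle-plus-triangles theorem of Fleischner
    and Stiebitz.

    Second set: split each K4 into two pairs, and on each cycle take a matching
    of consecutive vertices, missing one vertex (the root) if the length is
    odd.  The union of two matchings is bipartite, so there is a 2-colouring
    [x] splitting all these pairs.  Unless a root of an odd cycle of length at
    least 5 has the colour of both its neighbours, the monochromatic cycle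
    edges again form a matching, and a second 2-colouring of the colour classes
    gives four colours.  For a uniformly random choice of roots and [x] this
    failure has probability at most [l / 10] on a cycle of odd length
    [l >= 5]; delete the roots where it occurs. *)

(** * Paths plus triangles *)

Section CharTwo.
Local Open Scope ring_scope.
Variable R : comNzRingType.
Hypothesis char2 : 1 + 1 = 0 :> R.

Lemma addrr2 (x : R) : x + x = 0.
Proof. by rewrite -[x]mul1r -mulrDl char2 mul0r. Qed.

(** The points moved by [f] cancel in pairs; [enum_rank] selects one point of each pair. *)
Lemma sum_involution (I : finType) (P : pred I) (f : I -> I) (G : I -> R) :
  involutive f -> (forall x, P (f x) = P x) -> (forall x, P x -> G (f x) = G x) ->
  \sum_(x | P x) G x = \sum_(x | P x && (f x == x)) G x.
Proof.
move=> fK Pf Gf; rewrite (bigID (fun x => f x == x)) /=.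
rewrite -[RHS]addr0; congr (_ + _).
rewrite (bigID (fun x => enum_rank x < enum_rank (f x))%N) /=.
rewrite [X in _ + X](reindex_inj (inv_inj fK)) /=.
rewrite -[RHS](addrr2 (\sum_(i | P i && (f i != i) && (enum_rank i < enum_rank (f i))%N) G i)).
congr (_ + _); apply: eq_big => [x|x]; rewrite Pf fK; last first.
  by case/andP => /andP[Px _ _]; apply: Gf.
rewrite [x == _]eq_sym; case: (P x) => //=; case: (f x =P x) => //= /eqP fx.
rewrite -leqNgt leq_eqVlt; case: eqP => //= E.
by case/eqP: fx; apply/enum_rank_inj/val_inj.
Qed.

Definition upd (I : finType) (J : Type) (r : {ffun I -> J}) (i0 : I) (s : J) : {ffun I -> J} :=
  [ffun i => if i == i0 then s else r i].

Lemma updE (I : finType) (J : Type) (r : {ffun I -> J}) i0 s i :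
  upd r i0 s i = if i == i0 then s else r i.
Proof. by rewrite ffunE. Qed.

Lemma sum_upd0 (I J : finType) (i0 : I) (j0 : J) (G : {ffun I -> J} -> R) :
  (forall r, \sum_s G (upd r i0 s) = 0) -> \sum_r G r = 0.
Proof.
move=> G0; rewrite (partition_big (fun r : {ffun I -> J} => r i0) predT) //=.
transitivity (\sum_(r : {ffun I -> J} | r i0 == j0) \sum_s G (upd r i0 s)); last first.
  by rewrite big1.
rewrite exchange_big /=; apply: eq_bigr => s _.
rewrite (reindex_onto (fun r => upd r i0 s) (fun r => upd r i0 j0)) /=; last first.
  by move=> r /eqP <-; apply/ffunP => i; rewrite !ffunE; case: eqP => // ->.
apply: eq_bigl => r; rewrite updE !eqxx /=.
apply/eqP/eqP => [<-|rj]; first by rewrite !ffunE eqxx.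
by apply/ffunP => i; rewrite !ffunE; case: eqP => // ->.
Qed.

(* Expand the product over maps [f : j |-> i].  If [f] is not onto, the sum over
   the coordinate it misses vanishes; [f] and its inverse cancel; for an
   involution, [b ^ 2 = b] makes the sum over a moved coordinate vanish.  Only
   the identity remains. *)
Lemma sum_prod_symmetric (q : nat) (J : finType) (j0 : J)
    (b : 'I_q -> 'I_q -> J -> J -> R) :
  (forall i j r s, b j i r s = b i j s r) ->
  (forall i j r s, b j i r s * b j i r s = b j i r s) ->
  (forall i j r, i != j -> \sum_s b j i r s = 0) ->
  \sum_(r : {ffun 'I_q -> J}) \prod_j (1 + \sum_(i | i != j) b j i (r j) (r i))
    = #|J|%:R ^+ q.
Proof.
move=> bC bb b0.
pose F j i (r : {ffun 'I_q -> J}) := if i == j then 1 else b j i (r j) (r i).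
pose G (f : {ffun 'I_q -> 'I_q}) := \sum_r \prod_j F j (f j) r.
transitivity (\sum_f G f).
  rewrite exchange_big /=; apply: eq_bigr => r _.
  rewrite -(bigA_distr_bigA (fun j i => F j i r)); apply: eq_bigr => j _.
  rewrite [RHS](bigD1 j) //=; congr (_ + _); first by rewrite /F eqxx.
  by apply: eq_bigr => i /negPf ij; rewrite /F ij.
have Gsurj (f : {ffun 'I_q -> 'I_q}) : ~~ injectiveb f -> G f = 0.
  move=> ninj.
  have /existsP[i0 /negP i0P] : [exists i, i \notin codom f].
    apply: contraR ninj; rewrite negb_exists => /forallP surj.
    apply: (leq_size_uniq (enum_uniq 'I_q)) => [i _|]; last by rewrite size_map.
    by move: (surj i); rewrite negbK.
  apply: (@sum_upd0 _ _ i0 j0) => r.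
  have fi0 j : f j != i0 by apply/eqP => E; apply: i0P; rewrite -E codom_f.
  under eq_bigr => s _ do rewrite (bigD1 i0) //=.
  under eq_bigr => s _.
    rewrite (eq_bigr (fun j => F j (f j) r)); last first.
      by move=> j ji; rewrite /F !updE (negPf (fi0 j)) (negPf ji).
    over.
  rewrite -mulr_suml /F (negPf (fi0 i0)).
  rewrite (eq_bigr (b (f i0) i0 (r (f i0)))) => [|s _]; last first.
    by rewrite !updE eqxx (negPf (fi0 i0)) bC.
  by rewrite b0 ?mul0r // eq_sym.
have Ginv (f : {ffun 'I_q -> 'I_q}) i0 : f i0 != i0 -> f (f i0) = i0 -> injective f -> G f = 0.
  move=> fi ffi finj; apply: (@sum_upd0 _ _ i0 j0) => r.
  under eq_bigr => s _.
    rewrite (bigD1 i0) //= (bigD1 (f i0)) //= mulrA.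
    rewrite (eq_bigr (fun j => F j (f j) r)); last first.
      move=> j /andP[ji jf]; rewrite /F !updE (negPf ji).
      suff /negPf-> : f j != i0 by [].
      by apply: contra jf => /eqP E; apply/eqP/finj; rewrite E ffi.
    over.
  rewrite -mulr_suml /F (negPf fi) ffi.
  rewrite (eq_bigr (b (f i0) i0 (r (f i0)))) => [|s _]; last first.
    by rewrite !updE eqxx (negPf fi) eq_sym (negPf fi) [b i0 _ _ _]bC bb.
  by rewrite b0 ?mul0r // eq_sym.
rewrite (bigID (fun f : {ffun 'I_q -> 'I_q} => injectiveb f)) /= addrC big1 ?add0r //.
rewrite (reindex (@pval _)) /=; last first.
  pose in_Sn := insubd (1%g : 'S_q).
  by exists in_Sn => /= f Uf; first apply: val_inj; apply: insubdK.
rewrite (eq_bigl predT) => [|s]; last exact: (valP s).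
rewrite (@sum_involution _ _ (fun s : {perm 'I_q} => s^-1)%g) /=; first last.
- move=> s _; apply: eq_bigr => r _; rewrite [LHS](reindex_inj (@perm_inj _ s)) /=.
  by apply: eq_bigr => j _; rewrite /F !pvalE permK eq_sym bC.
- by [].
- exact: invgK.
rewrite (bigD1 1%g) /=; last by rewrite invg1 eqxx.
rewrite big1 ?addr0 => [|s /andP[/eqP sV s1]].
  rewrite /G (eq_bigr (fun=> 1)) => [|r _]; last first.
    by rewrite big1 // => j _; rewrite /F pvalE perm1 eqxx.
  by rewrite sumr_const card_ffun card_ord natrX.
have [i si] : exists i, s i != i.
  apply/existsP; apply: contraR s1; rewrite negb_exists => /forallP s1.
  by apply/eqP/permP => i; rewrite perm1; apply/eqP; move: (s1 i); rewrite negbK.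
apply: (Ginv _ i); rewrite ?pvalE ?si //; last exact: perm_inj.
by rewrite -{1}sV permK.
Qed.
End CharTwo.

Section PathTriangles.
Local Open Scope ring_scope.
Variables (F : fieldType) (X : 'I_3 -> F).
Hypothesis char2 : 1 + 1 = 0 :> F.
Hypothesis X_inj : injective X.

Lemma natr_odd n : (odd n)%:R = n%:R :> F.
Proof.
elim: n => //= n IH; rewrite -[n.+1]addn1 natrD -IH.
by case: (odd n); rewrite /= ?add0r ?char2.
Qed.

Lemma natr_addb (x y : bool) : (x (+) y)%:R = x%:R + y%:R :> F.
Proof. by case: x y => [] []; rewrite /= ?addr0 ?add0r ?char2. Qed.

Let D := \det (Vandermonde 3 (\row_k X k)).

Lemma vandermonde_neq0 : D != 0.
Proof.
rewrite /D det_Vandermonde; apply/prodf_neq0 => i _; apply/prodf_neq0 => j ij.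
by rewrite !mxE subr_eq0; apply: contraTneq ij => /X_inj ->; rewrite ltnn.
Qed.

Lemma permanent_char2 n (A : 'M[F]_n) : \sum_(s : 'S_n) \prod_i A i (s i) = \det A.
Proof.
apply: eq_bigr => s _; rewrite -[LHS]mul1r; congr (_ * _).
by case: (odd_perm s); rewrite ?expr1 ?expr0 //; apply/eqP; rewrite -addr_eq0 char2.
Qed.

(** Signs vanish in characteristic 2, so the sum is the determinant of the matrix with entries
    [X l ^+ u k]: zero if two exponents agree, and otherwise a Vandermonde determinant with permuted
    rows. *)
Lemma sum_triangle (u : 'I_3 -> nat) : (forall k, u k <= 2)%N ->
  \sum_(s : 'S_3) \prod_k X (s k) ^+ u k = (injectiveb u)%:R * D.
Proof.
move=> u2; pose A : 'M[F]_3 := \matrix_(k, l) X l ^+ u k.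
transitivity (\det A).
  rewrite -permanent_char2; apply: eq_bigr => s _; apply: eq_bigr => k _.
  by rewrite mxE.
case: injectiveP => [uinj|]; last first.
  case/injectiveP/injectivePn => k1 [k2 k12 e12]; rewrite mul0r.
  by apply: (determinant_alternate k12) => l; rewrite !mxE e12.
have vinj : injective (fun k => inord (u k) : 'I_3).
  by move=> k l /(congr1 val); rewrite /= !inordK ?ltnS // => /uinj.
have -> : A = row_perm (perm vinj) (Vandermonde 3 (\row_k X k)).
  by apply/matrixP => k l; rewrite !mxE permE inordK ?ltnS.
rewrite row_permE det_mulmx det_perm mul1r.
case: (odd_perm _); rewrite ?expr1 ?expr0 ?mulN1r ?mul1r //.
by apply/eqP; rewrite eq_sym -addr_eq0 addrr2.
Qed.

Section Expand.
Variables (m : nat).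
(* A choice of one endpoint of each edge of the path [0 - 1 - ... - m]: [obit o k]
   tells whether the edge [(k - 1, k)] chooses [k].  The nonexistent edges
   [(-1, 0)] and [(m, m + 1)] are taken to choose [0] and [m + 1], so that
   [oexp o k] is the number of edges choosing [k]. *)
Definition obit (o : {ffun 'I_m -> bool}) (k : nat) : bool :=
  if k is k'.+1 then (if insub k' is Some i then o i else true) else true.
Definition oexp o (k : nat) : nat := obit o k + ~~ obit o k.+1.

Lemma oexp_le2 o k : (oexp o k <= 2)%N.
Proof. by rewrite /oexp; case: obit; case: obit. Qed.

(** The factor [c 0] raises the degree from [m] to [m + 1], the number of vertices, as required for
    exponents 0, 1, 2 on every triangle. *)
Lemma expand_path (c : nat -> F) :
  c 0 * \prod_(i < m) (c i + c i.+1) =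
  \sum_(o : {ffun 'I_m -> bool}) \prod_(i < m.+1) c i ^+ oexp o i.
Proof.
transitivity (c 0 * \prod_(i < m) \sum_(b : bool) (if b then c i.+1 else c i)).
  by congr (_ * _); apply: eq_bigr => i _; rewrite big_bool addrC.
rewrite bigA_distr_bigA big_distrr /=; apply: eq_bigr => o _.
have ob i : obit o (val (i : 'I_m)).+1 = o i by rewrite /= valK.
have -> : \prod_(i < m.+1) c i ^+ oexp o i =
    (\prod_(i < m.+1) c i ^+ obit o i) * \prod_(i < m.+1) c i ^+ (~~ obit o i.+1).
  by rewrite -big_split; apply: eq_bigr => i _; rewrite exprD.
have om : obit o m.+1 by rewrite /= insubF ?ltnn.
rewrite big_ord_recl big_ord_recr [X in _ * (_ * X)](_ : _ = 1) ?mulr1; last first.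
  by rewrite (_ : ~~ _ = false) ?expr0 //; apply: negbTE; rewrite negbK.
rewrite -mulrA; congr (_ * _).
rewrite -big_split; apply: eq_bigr => i _.
rewrite lift0 !(ob i) /=; case: (o i); by rewrite ?expr0 ?mul1r ?mulr1.
Qed.
End Expand.
End PathTriangles.

Arguments obit : simpl never.

(** * Parity of the number of admissible endpoint choices *)

Section Count.
Local Open Scope ring_scope.
Variable F : fieldType.
Hypothesis char2 : 1 + 1 = 0 :> F.
Variables (m q : nat) (e : 'I_q -> 'I_3 -> 'I_m.+1) (P : 'I_m.+1 -> 'I_q) (K : 'I_m.+1 -> 'I_3).
Hypothesis eP : forall i, e (P i) (K i) = i.
Hypothesis Pe : forall j k, P (e j k) = j.
Hypothesis Ke : forall j k, K (e j k) = k.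

Implicit Types (r : {ffun 'I_q -> 'I_3}) (j i : 'I_q) (k s : 'I_3) (o : {ffun 'I_m -> bool}).

Lemma big_parts (R : Type) (idx : R) (op : Monoid.com_law idx) (G : 'I_m.+1 -> R) :
  \big[op/idx]_x G x = \big[op/idx]_j \big[op/idx]_k G (e j k).
Proof.
rewrite pair_big /= (reindex (fun x : 'I_q * 'I_3 => e x.1 x.2)) //=.
by exists (fun x => (P x, K x)) => [[j k] _|x _] /=; rewrite ?Pe ?Ke ?eP.
Qed.

Lemma e_eq j i k s : (e j k == e i s) = (j == i) && (k == s).
Proof.
apply/eqP/andP => [E|[/eqP-> /eqP->]] //.
by move: (congr1 P E) (congr1 K E); rewrite !Pe !Ke => -> ->; rewrite !eqxx.
Qed.

(* If each triangle receives the exponents 0, 1, 2 then the choice of endpoints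
   is determined by the map [r] giving the vertex of exponent 1 of each
   triangle: along the path the other vertices have exponents 2 and 0
   alternately.  [before r p] counts those among the first [p] vertices. *)
Definition before r (p : nat) : nat := (\sum_j \sum_(k | k != r j) (e j k < p))%N.

(** The value forced on [obit]: true at the start, it changes exactly at the vertices of exponent 0
    or 2. *)
Definition outbit r p : bool := ~~ odd (before r p).

Lemma outbit0 r : outbit r 0.
Proof. by rewrite /outbit /before big1 // => j _; rewrite big1. Qed.

Lemma outbit_last r : outbit r m.+1.
Proof.
rewrite /outbit /before (eq_bigr (fun=> 2%N)) ?sum_nat_const ?muln2 ?odd_double //.
move=> j _; rewrite (eq_bigr (fun=> 1%N)) => [|k _]; last by rewrite ltn_ord.
by rewrite sum1_card cardC1 card_ord.
Qed.

Lemma outbitS r j k : outbit r (e j k).+1 = outbit r (e j k) (+) (k != r j).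
Proof.
rewrite /outbit; suff -> : before r (e j k).+1 = (before r (e j k) + (k != r j))%N.
  by rewrite oddD oddb -addNb.
have lt1 i s : nat_of_bool (e i s < (e j k).+1)%N = ((e i s < e j k)%N + (e i s == e j k))%N.
  by rewrite ltnS leq_eqVlt -(inj_eq val_inj) /=; case: ltngtP.
rewrite /before; under eq_bigr => i _ do under eq_bigr => s _ do rewrite lt1.
under eq_bigr => i _ do rewrite big_split /=.
rewrite big_split /=; congr (_ + _)%N.
rewrite (bigD1 j) //= [X in (_ + X)%N]big1 => [|i ij]; last first.
  by rewrite big1 // => s _; rewrite e_eq (negPf ij).
rewrite addn0; under eq_bigr => s _ do rewrite e_eq eqxx /=.
case: (boolP (k != r j)) => kr /=; last first.
  by move: kr; rewrite negbK => /eqP->; rewrite big1 // => s /negPf->.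
rewrite (bigD1 k) //= eqxx big1 // => s /andP[_ /negPf->] //.
Qed.

Definition matches r o := [forall j, [forall k, (oexp o (e j k) == 1%N) == (k == r j)]
   && [forall k, forall l, (k != l) ==> (oexp o (e j k) != oexp o (e j l))]].

Lemma oexp1 o p : (oexp o p == 1%N) = (obit o p == obit o p.+1).
Proof. by rewrite /oexp; case: obit; case: obit. Qed.

Lemma obit_outbit r o p : matches r o -> (p <= m.+1)%N -> obit o p = outbit r p.
Proof.
move=> /forallP M; elim: p => [|p IH] pm; first by rewrite outbit0.
have /andP[/forallP M1 _] := M (P (Ordinal pm)).
have := M1 (K (Ordinal pm)); rewrite eP oexp1 /= => /eqP E.
have := outbitS r (P (Ordinal pm)) (K (Ordinal pm)); rewrite eP /= => ->.
by rewrite -E IH ?(ltnW pm) //; case: (obit o p.+1) (outbit r p) => [] [].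
Qed.

Definition outbits r : {ffun 'I_m -> bool} := [ffun i => outbit r (val i).+1].

Lemma obit_outbits r p : (p <= m.+1)%N -> obit (outbits r) p = outbit r p.
Proof.
case: p => [|p]; rewrite ?outbit0 // /obit ltnS leq_eqVlt => /orP[/eqP->|pm].
  by rewrite insubF ?ltnn // outbit_last.
by rewrite insubT ffunE.
Qed.

Lemma matches_outbits r o : matches r o -> o = outbits r.
Proof.
move=> M; apply/ffunP => i; rewrite ffunE -(obit_outbit M); last first.
  exact: leq_trans (ltn_ord i) (leqnSn m).
by rewrite /obit valK.
Qed.

(** Under the forced choice [r j] has exponent 1 and the other two vertices have 2 or 0 according to
    [outbit], so only these two can coincide. *)
Lemma matchesE r : matches r (outbits r) =
  [forall j, outbit r (e j (r j + 1)) != outbit r (e j (r j + 2%:R))].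
Proof.
have ob j k : obit (outbits r) (e j k) = outbit r (e j k) by rewrite obit_outbits // ltnW.
have obS j k : obit (outbits r) (e j k).+1 = outbit r (e j k) (+) (k != r j).
  by rewrite obit_outbits // outbitS.
apply: eq_forallb => j; rewrite [X in X && _](_ : _ = true) /=; last first.
  by apply/forallP => k; rewrite oexp1 ob obS; case: (k == r j); case: outbit.
have E k : oexp (outbits r) (e j k) = if k == r j then 1%N else (outbit r (e j k)).*2.
  by rewrite /oexp ob obS; case: (k == r j); case: outbit.
apply/forallP/idP => [H|H k].
  have /forallP/(_ (r j + 2%:R)) := H (r j + 1); rewrite !E.
  by case: (r j) => [[|[|[|]]]] //= ?; case: outbit; case: outbit.
apply/forallP => l; rewrite !E; apply/implyP; move: H.
have r3 (s : 'I_3) : [|| s == r j, s == r j + 1 | s == r j + 2%:R].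
  by case: (r j) => [[|[|[|]]]] //= ?; case: s => [[|[|[|]]]].
have n1 : r j + 1 != r j by case: (r j) => [[|[|[|]]]].
have n2 : r j + 2%:R != r j by case: (r j) => [[|[|[|]]]].
case/or3P: (r3 k) => /eqP->; case/or3P: (r3 l) => /eqP->;
  rewrite ?eqxx ?(negPf n1) ?(negPf n2) //; by case: outbit => //; case: outbit.
Qed.

Definition rainbow o j := injectiveb (fun k => oexp o (e j k)).

Lemma rainbow_through o j : (rainbow o j)%:R =
  \sum_r ([forall k, (oexp o (e j k) == 1%N) == (k == r)]
   && [forall k, forall l, (k != l) ==> (oexp o (e j k) != oexp o (e j l))])%:R :> F.
Proof.
have -> : rainbow o j = [forall k, forall l, (k != l) ==> (oexp o (e j k) != oexp o (e j l))].
  apply/injectiveP/forallP => [I k|I k l /eqP kl].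
    by apply/forallP => l; rewrite (inj_eq I) implybb.
  by apply/eqP; move: (forallP (I k) l); apply: contraTT => ->; rewrite negbK.
case: forallP => I; last by rewrite big1 // => r _; rewrite andbF.
under eq_bigr => r _ do rewrite andbT.
have [k /eqP kP] : exists k, oexp o (e j k) == 1%N.
  apply/existsP; apply: contraT; rewrite negb_exists => /forallP N.
  have := I 0; have := I 1 => /forallP/(_ 2%:R) + /forallP I0.
  move: (I0 1) (I0 2%:R) (N 0) (N 1) (N 2%:R); rewrite /=.
  have := oexp_le2 o (e j 0); have := oexp_le2 o (e j 1); have := oexp_le2 o (e j 2%:R).
  by case: (oexp o (e j 0)) => [|[|[|]]] //; case: (oexp o (e j 1)) => [|[|[|]]] //;
     case: (oexp o (e j 2%:R)) => [|[|[|]]].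
rewrite (bigD1 k) //= big1 => [|r rk]; last first.
  suff /negPf-> : ~~ [forall k, (oexp o (e j k) == 1%N) == (k == r)] by [].
  apply/forallP => /(_ k); by rewrite kP (eq_sym k) (negPf rk).
rewrite addr0; suff -> : [forall k0, (oexp o (e j k0) == 1%N) == (k0 == k)] by [].
apply/forallP => l; case: (l =P k) => [->|/eqP lk]; first by rewrite kP.
by have := forallP (I l) k; rewrite lk kP => /negPf->; rewrite eqxx.
Qed.

(** A choice that is rainbow on every triangle determines [r], and [r] determines the choice; both
    sides count the same pairs. *)
Lemma sum_rainbow : \sum_o \prod_j (rainbow o j)%:R = \sum_r (matches r (outbits r))%:R :> F.
Proof.
under eq_bigr => o _ do under eq_bigr => j _ do rewrite rainbow_through.
under eq_bigr => o _ do rewrite bigA_distr_bigA /=.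
rewrite exchange_big /=; apply: eq_bigr => r _.
under eq_bigr => o _ do rewrite -natr_prod.
have E o : (\prod_(j < q)
    ([forall k, (oexp o (e j k) == 1%N) == (k == r j)]
     && [forall k, forall l, (k != l) ==> (oexp o (e j k) != oexp o (e j l))]))%N = matches r o.
  rewrite /matches; case: forallP => [M|/forallP]; first by rewrite big1 // => j _; rewrite M.
  by rewrite negb_forall => /existsP[j /negPf Mj]; rewrite (bigD1 j) //= Mj.
under eq_bigr => o _ do rewrite E.
rewrite (bigD1 (outbits r)) //= big1 ?addr0 // => o oNout.
by case: (boolP (matches r o)) => // /matches_outbits Eo; rewrite Eo eqxx in oNout.
Qed.

(* The pair of triangle [j] other than [s] separates the pair of triangle [i]
   other than [t]. *)
Definition interlace j i (s t : 'I_3) : bool :=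
  [&& i != j & \big[addb/false]_(k | k != t)
    ((e j (s + 1)%R < e i k) (+) (e j (s + 2%:R)%R < e i k))%N].

Lemma lt_negb (x y : 'I_m.+1) : x != y -> (x < y)%N = ~~ (y < x)%N.
Proof. by rewrite -(inj_eq val_inj) /=; case: ltngtP. Qed.

Lemma big_other (R : Type) (idx : R) (op : Monoid.com_law idx) (s : 'I_3) (G : 'I_3 -> R) :
  \big[op/idx]_(k | k != s) G k = op (G (s + 1)) (G (s + 2%:R)).
Proof.
rewrite (bigD1 (s + 1)) /=; last by case: s => [[|[|[|]]]].
rewrite (bigD1 (s + 2%:R)) /=; last by case: s => [[|[|[|]]]].
rewrite big1 ?Monoid.mulm1 // => k.
by case: s => [[|[|[|]]]] // ?; case: k => [[|[|[|]]]].
Qed.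

(** The parity counts the vertices other than the [e i (r i)] in the interval between the two
    points, one end included: triangle [j] gives the 1, and triangle [i] gives an odd number exactly
    when its pair is separated. *)
Lemma before_interlace r j :
  (outbit r (e j (r j + 1)) != outbit r (e j (r j + 2%:R)))%:R
  = 1 + \sum_(i | i != j) (interlace j i (r j) (r i))%:R :> F.
Proof.
set a := e j (r j + 1); set b := e j (r j + 2%:R).
have -> : (outbit r a != outbit r b) = odd (before r a) (+) odd (before r b).
  by rewrite /outbit; case: odd; case: odd.
rewrite natr_addb // !natr_odd // !natr_sum -big_split /= (bigD1 j) //=.
have ab : a != b by rewrite e_eq eqxx /=; case: (r j) => [[|[|[|]]]].
congr (_ + _); last apply: eq_bigr => i ij.
  rewrite !big_other -/a -/b !ltnn.
  by move: ab; rewrite -(inj_eq val_inj) /=; case: ltngtP; rewrite ?addr0 ?add0r.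
rewrite /interlace ij /= (big_morph (fun c : bool => c%:R : F) (natr_addb char2) (erefl _)).
rewrite !natr_sum -big_split /=; apply: eq_bigr => k _; rewrite -natr_addb //.
have lt c : c = a \/ c = b -> (e i k < c)%N = ~~ (c < e i k)%N.
  by case=> ->; apply: lt_negb; rewrite e_eq (negPf ij).
by rewrite !lt; auto; case: ltnP; case: ltnP.
Qed.

Lemma sum_matches : \sum_r (matches r (outbits r))%:R = 1 :> F.
Proof.
pose b j i s t : F := (interlace j i s t)%:R.
transitivity (\sum_(r : {ffun 'I_q -> 'I_3}) \prod_j (1 + \sum_(i | i != j) b j i (r j) (r i))).
  apply: eq_bigr => r _; rewrite matchesE.
  under eq_bigr => j _ do rewrite -before_interlace.
  rewrite -natr_prod; congr (_%:R).
  case: forallP => [M|/forallP]; first by rewrite big1 // => j _; rewrite M.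
  by rewrite negb_forall => /existsP[j /negPf Mj]; rewrite (bigD1 j) //= Mj.
rewrite sum_prod_symmetric //.
- rewrite card_ord -natrX -natr_odd // oddX.
  by rewrite orbT.
- exact: 0.
- move=> i j s t; rewrite /b; congr (_%:R); congr (nat_of_bool _).
  rewrite /interlace eq_sym; case: (boolP (j != i)) => //= ij.
  have lt k l : (e j k < e i l)%N = ~~ (e i l < e j k)%N.
    by apply: lt_negb; rewrite e_eq (negPf ij).
  rewrite !big_other !lt.
  by do 4 case: leqP => _.
- by move=> i j s t; rewrite /b; case: interlace; rewrite ?mulr0 ?mulr1.
- move=> i j s ij; rewrite /b /interlace ij /=.
  (* Each vertex of triangle [i] lies in two of its three pairs, so it contributes twice. *)
  under eq_bigr => t _ do rewrite big_other natr_addb //.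
  pose f (k : 'I_3) : F := ((e j (s + 1)%R < e i k) (+) (e j (s + 2%:R)%R < e i k))%N%:R.
  have shift u : \sum_t f (t + u) = \sum_t f t by rewrite [RHS](reindex_inj (addIr u)).
  by rewrite big_split /= -/(f _) (shift 1) (shift 2%:R) addrr2.
Qed.
End Count.

Lemma fibre_enum (T : finType) (q k : nat) (P : T -> 'I_q) : T ->
  (forall j, #|[set i | P i == j]| = k.+1) ->
  exists (e : 'I_q -> 'I_k.+1 -> T) (K : T -> 'I_k.+1),
    [/\ forall i, e (P i) (K i) = i, forall j l, P (e j l) = j & forall j l, K (e j l) = l].
Proof.
move=> t0 cardP; pose A j := enum [set i | P i == j].
have szA j : size (A j) = k.+1 by rewrite -cardE.
pose e j (l : 'I_k.+1) := nth t0 (A j) l.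
have Pe j l : P (e j l) = j.
  have : e j l \in A j by rewrite mem_nth // szA.
  by rewrite mem_enum inE => /eqP.
exists e, (fun i => inord (index i (A (P i)))); split=> // [i|j l].
  have iA : i \in A (P i) by rewrite mem_enum inE.
  by rewrite /e inordK ?nth_index // -(szA (P i)) index_mem.
by rewrite Pe /e index_uniq ?szA ?enum_uniq // inord_val.
Qed.

Section PathColouring.
Local Open Scope ring_scope.

(** Polynomial method: over all colourings proper on the triangles, the path products sum to a power
    of a Vandermonde determinant. As this is nonzero, some product is nonzero, and its factors
    [c i + c i.+1] then show that consecutive vertices differ. *)
Theorem path_triangles (m q : nat) (P : 'I_m -> 'I_q) :
  (forall j, #|[set i | P i == j]| = 3) ->
  exists c : 'I_m -> 'I_3,
    (forall i k : 'I_m, k = i.+1 :> nat -> c i != c k) /\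
    (forall i k : 'I_m, i != k -> P i = P k -> c i != c k).
Proof.
case: m P => [P _|m P /(@fibre_enum _ _ 2 P ord0)[e [K [eP Pe Ke]]]].
  by exists (fun=> ord0); split=> [[]|[]].
(* The field with four elements: characteristic 2 and room for three distinct values. *)
have [F0 pF cF] := @pPrimePowerField 2 2 isT isT.
pose F : fieldType := F0.
have char2 : 1 + 1 = 0 :> F by have := pcharf0 pF; rewrite mulr2n.
have le34 : (3 <= #|F0|)%N by rewrite cF.
pose X (k : 'I_3) : F := enum_val (widen_ord le34 k).
have Xinj : injective X.
  by move=> k l /enum_val_inj /(congr1 val) /= /val_inj.
pose col (s : {ffun 'I_q -> 'S_3}) (i : 'I_m.+1) : 'I_3 := s (P i) (K i).
pose c s (k : nat) : F := X (col s (inord k)).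
pose S := \sum_s (c s 0 * \prod_(i < m) (c s i + c s i.+1)).
have Sneq0 : S != 0.
  pose D := \det (Vandermonde 3 (\row_k X k)).
  have -> : S = D ^+ q.
    rewrite /S; under eq_bigr => s _ do rewrite expand_path //.
    rewrite exchange_big /=.
    transitivity (\sum_(o : {ffun 'I_m -> bool}) \prod_j ((rainbow e o j)%:R * D)).
      apply: eq_bigr => o _.
      under eq_bigr => s _ do rewrite (big_parts eP Pe Ke) /=.
      transitivity (\sum_(s : {ffun 'I_q -> 'S_3})
          \prod_j \prod_k X (s j k) ^+ oexp o (e j k)).
        by apply: eq_bigr => s _; apply: eq_bigr => j _; apply: eq_bigr => k _;
           rewrite /c inord_val /col Pe Ke.
      rewrite -(bigA_distr_bigA (fun j (s : 'S_3) => \prod_k X (s k) ^+ oexp o (e j k))).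
      apply: eq_bigr => j _; rewrite sum_triangle // => k; exact: oexp_le2.
    under eq_bigr => o _ do rewrite big_split /= prodr_const card_ord.
    by rewrite -mulr_suml (sum_rainbow F eP Pe Ke) (sum_matches char2 Pe Ke) mul1r.
  by rewrite expf_neq0 // vandermonde_neq0.
have [s cs] : exists s, c s 0 * \prod_(i < m) (c s i + c s i.+1) != 0.
  apply/existsP; apply: contraNT Sneq0; rewrite negb_exists => /forallP s0.
  by rewrite /S big1 // => s _; apply/eqP; rewrite -[_ == 0]negbK.
exists (col s); split=> [i k ki|i k ik Pik].
  have im : (i < m)%N by rewrite -ltnS -ki.
  move: cs; rewrite mulf_eq0 negb_or => /andP[_ /prodf_neq0/(_ (Ordinal im) isT)].
  apply: contraNneq => E; rewrite /c -ki !inord_val E addrr2 //.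
rewrite /col Pik (inj_eq perm_inj); apply: contra ik => /eqP E.
by rewrite -(eP i) -(eP k) Pik E.
Qed.

End PathColouring.

(** * Colourings alternating along two involutions *)

Definition alternates (T : Type) (f : T -> T) (x : T -> bool) : Prop :=
  forall t, f t <> t -> x (f t) = ~~ x t.

Section TwoInvolutions.
Variables (T : finType) (f g : T -> T).
Hypotheses (fK : involutive f) (gK : involutive g).

(* The orbit of [t] under [f \o g] cannot contain [f t]: the reflection taking
   one to the other would fix a point of the orbit. *)
Lemma two_free_involutions :
  (forall t, f t != t) -> (forall t, g t != t) ->
  exists x : T -> bool, forall t, x (f t) = ~~ x t /\ x (g t) = ~~ x t.
Proof.
move=> fN gN; have hI : injective (f \o g) by apply: inj_comp; apply: inv_inj.
pose h := perm hI; have hE t : h t = f (g t) by rewrite permE.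
have fh t : f (h t) = g t by rewrite hE fK.
have hf t : h (f (h t)) = f t by rewrite fh hE gK.
have hiter k t : iter k h (f (iter k h t)) = f t.
  elim: k => //= k IH; transitivity (iter k h (h (f (h (iter k h t))))).
    by rewrite -iterSr.
  by rewrite hf.
pose O t := porbit h t.
have Of t : O (f t) != O t.
  apply/eqP => E; have : f t \in O t by rewrite -E porbit_id.
  case/porbitP => k; rewrite -(odd_double_half k) => E2.
  set m := k./2 in E2; set r := iter m h t.
  have hr : iter (odd k + m) h r = iter m h (f r).
    rewrite hiter E2 permX -iterD -[RHS]/(iter _ h _); congr (iter _ h t).
    by rewrite -addnn addnA.
  have {hr} : iter (odd k) h r = f r.
    have I : injective (iter m h) by elim: (m) => // n IH a b /= /perm_inj /IH.
    by apply: I; rewrite -hr -iterD addnC.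
  case: odd => /= [E3|/esym/eqP]; last by rewrite (negPf (fN r)).
  have : g r = r by rewrite -fh E3 fK.
  by move/eqP; rewrite (negPf (gN r)).
have Og t : O (g t) = O (f t).
  rewrite -fh; apply/esym/eqP; rewrite eq_porbit_mem; apply/porbitP; exists 1%N.
  by rewrite expg1 hf.
have Ofg t : O (f (g t)) = O t.
  rewrite -hE; apply/eqP; rewrite eq_porbit_mem; apply/porbitP; exists 1%N.
  by rewrite expg1.
(* Passing from [t] to [f t] or to [g t] exchanges the orbits [O t] and [O (f t)], so comparing
   their ranks gives opposite values. *)
pose x t := enum_rank (O t) < enum_rank (O (f t)).
have xN a b : O a != O b ->
    (enum_rank (O a) < enum_rank (O b)) = ~~ (enum_rank (O b) < enum_rank (O a)).
  rewrite -(inj_eq enum_rank_inj) -(inj_eq val_inj) /=; by case: ltngtP.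
exists x => t; rewrite /x fK Og Ofg; have := Of t; split; exact: xN.
Qed.
End TwoInvolutions.

(** Fixed points are removed by doubling the set: a point fixed by an involution is exchanged with
    its copy. *)
Lemma two_involutions (T : finType) (f g : T -> T) :
  involutive f -> involutive g ->
  exists x : T -> bool, alternates f x /\ alternates g x.
Proof.
move=> fK gK.
pose ext (h : T -> T) (u : T * bool) := if h u.1 == u.1 then (u.1, ~~ u.2) else (h u.1, u.2).
have extK h : involutive h -> involutive (ext h).
  move=> hK [t b]; rewrite /ext /=; case: (h t =P t) => [E|/eqP E] /=.
    by rewrite E eqxx negbK.
  by rewrite hK eq_sym (negPf E).
have extN h u : ext h u != u.
  case: u => t b; rewrite /ext /=; case: ifP => E; rewrite xpair_eqE /= ?E //.
  by rewrite eqxx; case: b.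
have [x xP] := two_free_involutions (extK f fK) (extK g gK) (extN f) (extN g).
exists (fun t => x (t, false)); split=> t /eqP/negPf E.
  by have := (xP (t, false)).1; rewrite /ext /= E.
by have := (xP (t, false)).2; rewrite /ext /= E.
Qed.

(** * Components of the union of two involutions *)

Section Strand.
Variables (T : finType) (p q : T -> T).
Hypotheses (pK : involutive p) (qK : involutive q) (pN : forall t, p t <> t).

Definition strand : rel T := connect [rel t u | (u == p t) || (u == q t)].

Lemma strand_sym : symmetric strand.
Proof.
apply: sym_connect_sym => t u /=.
by rewrite [u == p t]eq_sym [u == q t]eq_sym (inv_eq pK) (inv_eq qK).
Qed.

Lemma strand_p t u : strand t (p u) = strand t u.
Proof.
rewrite /strand; apply: same_connect_r; first exact: strand_sym.
by apply: connect1; rewrite /= pK eqxx.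
Qed.

Lemma strand_q t u : strand t (q u) = strand t u.
Proof.
rewrite /strand; apply: same_connect_r; first exact: strand_sym.
by apply: connect1; rewrite /= qK eqxx orbT.
Qed.

(** Starting at [c], apply [p] and [q] alternately until [q] fixes a vertex [e = p (u k)]. The walk
    has [2 k + 1] steps, an odd number, whence the opposite colour. *)
Lemma strand_end c : q c = c ->
  exists e, [/\ strand c e, forall t, strand c t -> q t = t -> t = c \/ t = e
    & forall x, alternates p x -> alternates q x -> x e = ~~ x c].
Proof.
move=> qc; pose h t := q (p t); have hI : injective h by move=> a b /(inv_inj qK)/(inv_inj pK).
pose u j := iter j h c.
have stu j : strand c (u j).
  elim: j => [|j IH]; first exact: connect0.
  by rewrite -[u _]/(q (p (u j))) strand_q strand_p.
have [k /eqP fixk mink] : {k | q (p (u k)) == p (u k) &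
    forall j, q (p (u j)) == p (u j) -> k <= j}.
  have ex : exists k, q (p (u k)) == p (u k).
    (* Finiteness: [h] returns to [c], and the vertex before the last [q] is then [q c = c], fixed
       by [q]. *)
    have E : q (p (u (fingraph.order h c).-1)) = c.
      by rewrite -[LHS]/(h (u _)) -iterS prednK ?order_gt0 // iter_order.
    by exists (fingraph.order h c).-1; rewrite E -[X in _ == X]qK E qc.
  by case: (ex_minnP ex) => k k1 k2; exists k.
exists (p (u k)); split; first by rewrite strand_p.
  pose A t := exists2 j, j <= k & t = u j \/ t = p (u j).
  have Ap t : A t -> A (p t).
    by case=> j jk [->|->]; exists j => //; [right|left; rewrite pK].
  have Aq t : A t -> A (q t).
    case=> j jk [->|->].
      case: j jk => [|j] jk; first by exists 0 => //; left.
      by exists j; [exact: ltnW|right; rewrite /u /= /h qK].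
    move: jk; rewrite leq_eqVlt => /orP[/eqP->|jk]; first by exists k => //; right.
    by exists j.+1 => //; left.
  have Ac t : strand c t -> A t.
    case/connectP => w cw ->; have : A c by exists 0 => //; left.
    elim: w (c) cw => [|a w IH] b //= /andP[/orP[]/eqP-> aw] Ab; apply: IH => //.
      exact: Ap.
    exact: Aq.
  move=> t /Ac[j jk [->|->]] qfix.
    case: j jk qfix => [|j] jk; first by left.
    rewrite /u /= -/(u j) {1}/h qK => /eqP; rewrite /h eq_sym => /mink.
    by rewrite leqNgt jk.
  by right; congr (p (u _)); apply/eqP; rewrite eqn_leq jk mink // qfix.
move=> x xp xq; rewrite xp //; congr (~~ _).
have : k <= k by []; elim: {1 3}k => //= j IH jk.
rewrite /h xq ?xp ?negbK ?IH //; first exact: ltnW.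
by move/eqP/mink; rewrite leqNgt jk.
Qed.
End Strand.

(** * Random roots *)

(* A word is the sequence of colours read along an odd cycle from its root. *)
Fixpoint pairs_ok (w : seq bool) : bool :=
  if w is a :: b :: w' then (a != b) && pairs_ok w' else true.

Definition rooted_ok (w : seq bool) : bool := pairs_ok (behead w).

(** The second and the last letter are the two neighbours of the root on the cycle. *)
Definition rooted_bad (w : seq bool) : bool :=
  if w is a :: b :: w' then [&& a == b, a == last b w' & rooted_ok w] else false.

Definition num_roots (good : pred (seq bool)) (w : seq bool) : nat :=
  count (fun v => good (rot v w)) (iota 0 (size w)).

(** Position [ij.1] is written last, so that a link [(i, i)] receives [b]. *)
Definition set_link (ij : nat * nat) (b : bool) (w : seq bool) : seq bool :=
  set_nth false (set_nth false w ij.2 (~~ b)) ij.1 b.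

(* The sum of [f] over the words in which [i] and [j] have opposite colours for
   each link [(i, j)] of [ls]; a link [(i, i)] stands for a free position. *)
Fixpoint sum_links (ls : seq (nat * nat)) (w : seq bool) (f : seq bool -> nat) : nat :=
  if ls is ij :: ls' then
    sum_links ls' (set_link ij false w) f + sum_links ls' (set_link ij true w) f
  else f w.

(** The partial matchings of the positions in [l], an unmatched position giving [(i, i)]; [n] is
    fuel, at least the size of [l]. *)
Fixpoint all_links (n : nat) (l : seq nat) : seq (seq (nat * nat)) :=
  if n is n'.+1 then
    if l is i :: l' then
      map (cons (i, i)) (all_links n' l') ++
      flatten [seq map (cons (i, j)) (all_links n' (rem j l')) | j <- l']
    else [:: [::]]
  else [:: [::]].

(* For an odd cycle of length [n] whose vertices are linked by strands through
   the rest of the graph in an arbitrary way, a random root and colouring are bad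
   with probability at most [n / 10].  The true bounds are 1/2, 1/2 and 7/10
   for [n] = 5, 7 and 9. *)
Definition check_length (n : nat) : bool :=
  all (fun ls => let w := nseq n false in
     10 * sum_links ls w (num_roots rooted_bad) <= n * sum_links ls w (num_roots rooted_ok))
   (all_links n (iota 0 n)).

Lemma all_links_complete (mate : nat -> nat) n l :
  uniq l -> size l <= n -> {in l, forall i, mate i \in l} ->
  {in l, forall i, mate (mate i) = i} ->
  exists2 ls, ls \in all_links n l &
    (forall ij, ij \in ls -> ij.1 \in l /\ ij.2 = mate ij.1) /\
    (forall k, k \in l -> exists2 ij, ij \in ls & k = ij.1 \/ k = ij.2).
Proof.
elim: n l => [|n IH] [|i l] //=; try by exists [::].
case/andP=> il ul; rewrite ltnS => szl inl mateK.
have mate_inj a b : a \in i :: l -> b \in i :: l -> mate a = mate b -> a = b.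
  by move=> /mateK {2}<- /mateK {2}<- ->.
case: (mate i =P i) => [fi|fi].
  have [|k kl|k kl|ls lsP [ls1 ls2]] := IH l ul.
  - exact: szl.
  - have := inl k; rewrite !inE kl orbT => /(_ isT)/orP[/eqP E|//].
    have ki : k = i by rewrite -(mateK k) ?E // inE kl orbT.
    by rewrite -ki kl in il.
  - by apply: mateK; rewrite inE kl orbT.
  exists ((i, i) :: ls); first by rewrite mem_cat map_f.
  split=> [ij|k]; rewrite inE => /orP[/eqP->|]; rewrite ?inE ?eqxx //=.
  - by case/ls1 => -> ->; rewrite orbT.
  - by exists (i, i); rewrite ?inE ?eqxx //; left.
  by case/ls2 => ij ijl E; exists ij; rewrite // inE ijl orbT.
have ml : mate i \in l by have := inl i; rewrite !inE eqxx => /(_ isT)/orP[/eqP|].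
have memr k : k \in rem (mate i) l = (k != mate i) && (k \in l) by rewrite mem_rem_uniq // inE.
have [||k|k|ls lsP [ls1 ls2]] := IH (rem (mate i) l).
- exact: rem_uniq.
- by rewrite size_rem // (leq_trans _ szl) // leq_pred.
- rewrite memr => /andP[kj kl]; have kil : k \in i :: l by rewrite inE kl orbT.
  have := inl k kil; rewrite memr inE => /orP[/eqP E|mkl].
    by rewrite -E mateK ?eqxx in kj.
  rewrite mkl andbT; apply: contraNneq il => /mate_inj <- //; rewrite inE ?eqxx ?kl ?orbT //.
- by rewrite memr => /andP[_ kl]; apply: mateK; rewrite inE kl orbT.
exists ((i, mate i) :: ls).
  rewrite mem_cat; apply/orP; right; apply/flattenP.
  exists (map (cons (i, mate i)) (all_links n (rem (mate i) l))); last exact: map_f.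
  exact: (map_f (fun j => map (cons (i, j)) (all_links n (rem j l)))).
split=> [ij|k]; rewrite inE => /orP[/eqP->|]; rewrite ?inE ?eqxx //=.
- by case/ls1; rewrite memr => /andP[_ ->] ->; rewrite orbT.
- by exists (i, mate i); rewrite ?inE ?eqxx //; left.
case: (k =P mate i) => [-> _|/eqP kj kl]; first by exists (i, mate i); rewrite ?inE ?eqxx //; right.
by case: (ls2 k) => [|ij ijl E]; rewrite ?memr ?kj //; exists ij; rewrite // inE ijl orbT.
Qed.

Lemma size_set_link ij b w : ij.1 < size w -> ij.2 < size w -> size (set_link ij b w) = size w.
Proof.
move=> h1 h2; rewrite /set_link !size_set_nth.
by rewrite !(maxn_idPr _) ?size_set_nth ?(maxn_idPr _).
Qed.

Lemma nth_set_link ij b w k : nth false (set_link ij b w) k =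
  if k == ij.1 then b else if k == ij.2 then ~~ b else nth false w k.
Proof. by rewrite /set_link !nth_set_nth /= nth_set_nth. Qed.

(** Positions covered by a link get overwritten, which allows the constant word in
    [check_length]. *)
Lemma eq_sum_links ls w w' f : size w = size w' ->
  (forall ij, ij \in ls -> ij.1 < size w /\ ij.2 < size w) ->
  (forall k, k < size w -> nth false w k = nth false w' k \/
     exists2 ij, ij \in ls & k = ij.1 \/ k = ij.2) ->
  sum_links ls w f = sum_links ls w' f.
Proof.
elim: ls w w' => [|ij ls IH] w w' sz lt agree /=.
  congr f; apply: (@eq_from_nth _ false) => // k /agree[//|[]//].
have [l1 l2] := lt ij (mem_head _ _).
have sz1 b : size (set_link ij b w) = size w by rewrite size_set_link.
have sz2 b : size (set_link ij b w') = size w' by rewrite size_set_link -?sz.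
have H b : sum_links ls (set_link ij b w) f = sum_links ls (set_link ij b w') f.
  apply: IH => [|kl kls|k]; rewrite ?sz1 ?sz2 //.
    by apply: lt; rewrite inE kls orbT.
  move=> /agree; rewrite !nth_set_link => -[->|[kl]]; first by left.
  rewrite inE => /orP[/eqP->|kls E]; last by right; exists kl.
  by case=> ->; left; rewrite eqxx.
by rewrite !H.
Qed.

Definition alternatesb (T : finType) (f : T -> T) (x : T -> bool) : bool :=
  [forall t, (f t != t) ==> (x (f t) == ~~ x t)].

Lemma alternatesP (T : finType) (f : T -> T) (x : T -> bool) :
  reflect (alternates f x) (alternatesb f x).
Proof.
apply: (iffP forallP) => H t; first by move/eqP => ft; apply/eqP/(implyP (H t)).
by apply/implyP => /eqP /H ->.
Qed.

(* Flipping a strand is an involution on the colourings alternating along [p] and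
   [q], so the colours on [cs] are uniformly distributed among those compatible
   with the links. *)
Section StrandAverage.
Variables (T : finType) (p q : T -> T).
Hypotheses (pK : involutive p) (qK : involutive q) (pN : forall t, p t <> t).
Variable cs : seq T.
Hypotheses (csU : uniq cs) (qcs : forall c, c \in cs -> q c = c).

Let X := [pred x : {ffun T -> bool} | alternatesb p x && alternatesb q x].
Let word (x : {ffun T -> bool}) := map x cs.

Definition toggle c (x : {ffun T -> bool}) := [ffun t => x t (+) strand p q c t].

Lemma toggleK c : involutive (toggle c).
Proof. by move=> x; apply/ffunP => t; rewrite !ffunE -addbA addbb addbF. Qed.

Lemma toggle_proper c x : X (toggle c x) = X x.
Proof.
suff H y : X y -> X (toggle c y) by apply/idP/idP => /H; rewrite ?toggleK.
case/andP=> /alternatesP yp /alternatesP yq; apply/andP; split; apply/alternatesP => t ft.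
  by rewrite !ffunE (strand_p pK qK) yp // addNb.
by rewrite !ffunE (strand_q pK qK) yq // addNb.
Qed.

Definition linked (ij : nat * nat) : Prop :=
  [/\ ij.1 < size cs, ij.2 < size cs,
    forall c0 k, k < size cs ->
      strand p q (nth c0 cs ij.1) (nth c0 cs k) = (k == ij.1) || (k == ij.2) &
    forall c0 x, X x -> ij.1 != ij.2 -> x (nth c0 cs ij.2) = ~~ x (nth c0 cs ij.1)].

(** Setting a link to either value yields the word of [x] and that of [x] with the strand of [ij.1]
    toggled. Toggling permutes the proper colourings, so each link contributes a factor 2. *)
Lemma sum_sum_links ls f : (forall ij, ij \in ls -> linked ij) ->
  \sum_(x | X x) sum_links ls (word x) f = 2 ^ size ls * \sum_(x | X x) f (word x).
Proof.
elim: ls => [|ij ls IH] lk /=; first by rewrite mul1n.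
have [l1 l2 st op] := lk ij (mem_head _ _).
have c0 : T by case: (cs) l1 => // c0 *; exact: c0.
set c := nth c0 cs ij.1.
pose G w := sum_links ls w f.
transitivity (\sum_(x | X x) (G (word x) + G (word (toggle c x)))).
  apply: eq_bigr => x Xx; rewrite -/(G _) -/(G _).
  have E1 : set_link ij (x c) (word x) = word x.
    apply: (@eq_from_nth _ false) => [|k]; rewrite size_set_link ?size_map // => kn.
    rewrite nth_set_link (nth_map c0) //; case: eqP => [->//|k1]; case: eqP => [k2|//].
    by rewrite k2 op // eq_sym -k2; apply/eqP.
  have E2 : set_link ij (~~ x c) (word x) = word (toggle c x).
    apply: (@eq_from_nth _ false) => [|k]; rewrite size_set_link ?size_map // => kn.
    rewrite nth_set_link !(nth_map c0) // ffunE st //.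
    case: eqP => [->|k1]; first by rewrite addbT.
    case: eqP => [k2|k2]; last by rewrite addbF.
    by rewrite k2 op ?addbT // eq_sym -k2; apply/eqP.
  by case: (x c) E1 E2 => /= -> ->; rewrite // addnC.
have -> : \sum_(x | X x) (G (word x) + G (word (toggle c x))) = 2 * \sum_(x | X x) G (word x).
  rewrite big_split mul2n -addnn; congr (_ + _).
  rewrite [LHS](reindex_inj (inv_inj (toggleK c))).
  by apply: eq_big => x *; rewrite ?toggle_proper ?toggleK.
rewrite IH; last by move=> kl kls; apply: lk; rewrite inE kls orbT.
by rewrite expnS mulnA.
Qed.

Lemma average : check_length (size cs) ->
  10 * \sum_(x | X x) num_roots rooted_bad (word x)
   <= size cs * \sum_(x | X x) num_roots rooted_ok (word x).
Proof.
move=> chk; case: (posnP (size cs)) => [/size0nil E|cs_gt0].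
  by rewrite /word E big1.
have c0 : T by case: (cs) cs_gt0 => // c0 *; exact: c0.
(* The strand of a vertex of [cs] has at most one other end, so it meets [cs] in at most one further
   position, the mate. *)
pose others i := [seq k <- iota 0 (size cs) | (k != i) && strand p q (nth c0 cs i) (nth c0 cs k)].
pose mate i := head i (others i).
have ends i j k : i < size cs -> j < size cs -> k < size cs -> j != i ->
    strand p q (nth c0 cs i) (nth c0 cs j) -> strand p q (nth c0 cs i) (nth c0 cs k) ->
    k = i \/ k = j.
  move=> il jl kl ji sj sk.
  have [e [_ two _]] := strand_end pK qK pN (qcs (mem_nth c0 il)).
  have inj a b : a < size cs -> b < size cs -> nth c0 cs a = nth c0 cs b -> a = b.
    by move=> al bl /eqP; rewrite nth_uniq // => /eqP.
  case: (two _ sk (qcs (mem_nth c0 kl))) => [/inj->//|ek]; first by left.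
  case: (two _ sj (qcs (mem_nth c0 jl))) => [/inj E|ej]; first by rewrite E ?eqxx in ji.
  by right; apply: inj; rewrite // ek ej.
have mateP i : i < size cs -> mate i = i /\ others i = [::] \/
   [/\ mate i != i, mate i < size cs & strand p q (nth c0 cs i) (nth c0 cs (mate i))].
  move=> il; case E: (others i) => [|j s]; first by left; rewrite /mate E.
  right; rewrite /mate E /=.
  have : j \in others i by rewrite E mem_head.
  by rewrite mem_filter mem_iota /= add0n => /andP[/andP[-> ->] ->].
have mateK i : i < size cs -> mate (mate i) = i.
  move=> il; case: (mateP i il) => [[Ei _]|[ni jl st]]; first by rewrite !Ei.
  case: (mateP _ jl) => [[_ E]|[nk kl sk]].
    suff : i \in others (mate i) by rewrite E.
    by rewrite mem_filter eq_sym ni strand_sym // st mem_iota.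
  case: (ends i (mate i) (mate (mate i)) il jl kl ni st) => // [|E].
    by move: sk st; rewrite /strand => sk st; apply: connect_trans st sk.
  by rewrite {1}E eqxx in nk.
have [||i|i|ls lsP [ls1 ls2]] := @all_links_complete mate (size cs) (iota 0 (size cs)).
- exact: iota_uniq.
- by rewrite size_iota.
- by rewrite !mem_iota /= !add0n => il; case: (mateP i il) => [[->]|[]].
- by rewrite mem_iota => /mateK.
have lk ij : ij \in ls -> linked ij.
  case: ij => i j /ls1 /=; rewrite mem_iota /= add0n => -[il ->]; split=> //=.
  - by case: (mateP i il) => [[->]|[]].
  - move=> c1 k kl; rewrite !(set_nth_default c0) //; apply/idP/orP => [st|].
      case: (mateP i il) => [[Ei Eo]|[ni jl sj]]; last first.
        by case: (ends i _ k il jl kl ni sj st) => ->; [left|right].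
      left; apply: contraT => ki; suff : k \in others i by rewrite Eo.
      by rewrite mem_filter ki st mem_iota.
    case=> /eqP->; first exact: connect0.
    by case: (mateP i il) => [[->]|[]] // _; exact: connect0.
  - move=> c1 x /andP[/alternatesP xp /alternatesP xq]; rewrite eq_sym => ni.
    case: (mateP i il) => [[Ei Eo]|[_ jl sj]]; first by rewrite Ei eqxx in ni.
    rewrite !(set_nth_default c0) //.
    have [e [_ two <-]] // := strand_end pK qK pN (qcs (mem_nth c0 il)).
    case: (two _ sj (qcs (mem_nth c0 jl))) => [/eqP|->] //.
    by rewrite nth_uniq // (negPf ni).
(* Multiplying by the number of link values makes the inequality hold for each [x] separately, by
   the computed check. *)
have pos : 0 < 2 ^ size ls by rewrite expn_gt0.
rewrite -(leq_pmul2l pos) mulnCA -sum_sum_links // [leqRHS]mulnCA -sum_sum_links //.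
rewrite !big_distrr /=; apply: leq_sum => x _.
have E f : sum_links ls (word x) f = sum_links ls (nseq (size cs) false) f.
  apply: eq_sum_links; rewrite size_map ?size_nseq //.
    by move=> ij /lk[].
  by move=> k kn; right; apply: ls2; rewrite mem_iota.
by rewrite !E; exact: (allP chk _ lsP).
Qed.
End StrandAverage.

Lemma pairs_okP (T : Type) (s : T -> T) (x : T -> bool) n u :
  reflect (forall j, j < n -> x (iter j.*2.+1 s u) = ~~ x (iter j.*2 s u))
          (pairs_ok (map x (traject s u n.*2))).
Proof.
elim: n u => [|n IH] u /=; first by apply: ReflectT.
have E k : iter k.+2 s u = iter k s (s (s u)) by rewrite !iterSr.
apply: (iffP andP) => [[x0 /IH xS] [|j] jn|H].
- by rewrite /=; case: (x u) (x (s u)) x0 => [] [].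
- by rewrite doubleS !E; apply: xS.
split; first by have /= := H 0 isT; case: (x u) (x (s u)) => [] [].
by apply/IH => j jn; have := H j.+1 jn; rewrite doubleS !E.
Qed.

Lemma rot_traject (T : Type) (s : T -> T) u n k :
  iter n s u = u -> k <= n -> rot k (traject s u n) = traject s (iter k s u) n.
Proof.
move=> un; elim: k => [|k IH] kn; first by rewrite rot0.
rewrite rotS ?size_traject // IH ?(ltnW kn) //.
case: n un kn {IH} => // n un _; rewrite {1}trajectS rot1_cons trajectSr; congr rcons.
by rewrite -iterSr -iterD addnC iterD un.
Qed.

(** * Rooted cycles of a permutation *)

Section Mate.
Variables (T : finType) (s : {perm T}).
Implicit Types (t u v : T) (r : {ffun {set T} -> T}) (x : {ffun T -> bool}).

Notation len v := #|porbit s v|.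

Lemma iter_len v : iter (len v) s v = v.
Proof. exact: iter_porbit. Qed.

Lemma len_gt0 v : 0 < len v.
Proof. by apply/card_gt0P; exists v; apply: porbit_id. Qed.

Lemma porbit_iter k v : porbit s (iter k s v) = porbit s v.
Proof. by apply/eqP; rewrite eq_porbit_mem -permX mem_porbit. Qed.

Lemma porbit_perm v : porbit s (s v) = porbit s v.
Proof. exact: (porbit_iter 1). Qed.

Lemma porbit_permV v : porbit s ((s^-1)%g v) = porbit s v.
Proof. by rewrite -[in RHS](permKV s v) porbit_perm. Qed.

Lemma mem_porbitE t v : t \in porbit s v -> porbit s t = porbit s v.
Proof. by rewrite -eq_porbit_mem => /eqP. Qed.

Lemma porbit_iterP t v : t \in porbit s v -> exists2 k, k < len v & t = iter k s v.
Proof.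
rewrite porbit_traject => /trajectP[k kl ->]; by exists k.
Qed.

(* With [d] the distance of [t] from the root of its cycle along [s], the
   vertices at distances 1 and 2, 3 and 4, ... are mates.  The root is matched
   only if the length is even. *)
Definition mate r t : T :=
  let v := r (porbit s t) in
  let d := index t (traject s v (len t)) in
  if odd d then s t else if (d == 0) && odd (len t) then t else (s^-1)%g t.

Lemma mate_iter r v k : r (porbit s v) = v -> k < len v ->
  mate r (iter k s v) =
    if odd k then iter k.+1 s v else
    if k is k'.+1 then iter k' s v else
    if odd (len v) then v else iter (len v).-1 s v.
Proof.
move=> rv kl; rewrite /mate porbit_iter rv.
have -> : index (iter k s v) (traject s v (len v)) = k.
  rewrite -(nth_traject s kl v) index_uniq ?size_traject //; exact: uniq_traject_porbit.
case: ifP => // _; case: k kl => [|k] kl /=; last by rewrite permK.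
case: ifP => // _; apply: (@perm_inj _ s); rewrite permKV -iterS prednK ?len_gt0 //.
by rewrite iter_len.
Qed.

Definition roots_valid r := [forall t, r (porbit s t) \in porbit s t].

Lemma root_porbit r t : roots_valid r ->
  exists v k, [/\ r (porbit s v) = v, porbit s v = porbit s t, k < len v & t = iter k s v].
Proof.
move=> /forallP/(_ t) rt; set v := r (porbit s t) in rt.
have E := mem_porbitE rt; have : t \in porbit s v by rewrite E porbit_id.
by case/porbit_iterP => k kl tE; exists v, k; split; rewrite // E.
Qed.

Lemma mateK r : roots_valid r -> involutive (mate r).
Proof.
move=> rok t; have [v [k [rv _ kl ->]]] := root_porbit t rok.
rewrite mate_iter //; case: ifP => [ko|ke].
  move: (kl); rewrite leq_eqVlt => /orP[/eqP kl1|kl1]; last by rewrite mate_iter //= ko.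
  rewrite kl1 iter_len -[X in mate r X]/(iter 0 s v) mate_iter ?len_gt0 //=.
  by rewrite -kl1 /= ko.
case: k kl ke => [|k] kl ke; last by rewrite mate_iter ?(ltnW kl) // (negbFE ke : odd k).
case: ifP => lo; first by rewrite -[X in mate r X]/(iter 0 s v) mate_iter //= lo.
rewrite mate_iter ?prednK ?leqnn //.
have -> : odd (len v).-1 by move: lo; rewrite -{1}(prednK (len_gt0 v)) /= => /negbFE.
by rewrite iter_len.
Qed.

Lemma porbit_mate r t : porbit s (mate r t) = porbit s t.
Proof.
by rewrite /mate; case: ifP; rewrite ?porbit_perm //; case: ifP; rewrite ?porbit_permV.
Qed.

(** From the root of an odd cycle, mates are at distances [2 j + 1] and [2 j + 2]: the pairs tested
    once the root is dropped from the word. *)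
Lemma rooted_okP r v (x : T -> bool) : r (porbit s v) = v -> odd (len v) ->
  reflect (forall t, t \in porbit s v -> mate r t <> t -> x (mate r t) = ~~ x t)
   (rooted_ok (map x (traject s v (len v)))).
Proof.
move=> rv lo; have E : len v = (len v)./2.*2.+1 by rewrite -[LHS]odd_double_half lo.
set n := (len v)./2 in E.
have -> : rooted_ok (map x (traject s v (len v))) = pairs_ok (map x (traject s (s v) n.*2)).
  by rewrite E.
apply: (iffP (pairs_okP s x n (s v))) => [H t|H j jn].
  case/porbit_iterP => k kl ->; rewrite mate_iter // lo.
  case: (boolP (odd k)) => [ko _|ke].
    have kE : k = k./2.*2.+1 by rewrite -[LHS]odd_double_half ko.
    have := H k./2; rewrite -!iterSr -kE; apply.
    by rewrite -ltn_double -ltnS -kE -E.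
  case: k kl ke => [|k] kl ke; first by [].
  rewrite /= negbK in ke.
  have kE : k = k./2.*2.+1 by rewrite -[LHS]odd_double_half ke.
  have := H k./2; rewrite -!iterSr -kE => -> //; first by rewrite negbK.
  by rewrite -ltn_double -ltnS -kE -E ltnW.
have kl : j.*2.+1 < len v by rewrite E ltnS ltn_double.
have := H (iter j.*2.+1 s v); rewrite mate_iter //= odd_double /= -!iterS -!iterSr.
apply; first by rewrite -permX mem_porbit.
move=> E2; have := uniq_traject_porbit s v.
have kl2 : j.*2.+2 < len v by rewrite E ltnS -doubleS leq_double.
move=> U; have := nth_uniq v _ _ U; rewrite size_traject => /(_ _ _ kl2 kl).
by rewrite !nth_traject // E2 eqxx eqn_leq ltnn.
Qed.

Definition proper (p : T -> T) r x := alternatesb p x && alternatesb (mate r) x.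

Definition bad r (C : {set T}) x :=
  (x (r C) == x (s (r C))) && (x (r C) == x ((s^-1)%g (r C))).

Lemma mate_upd_out r C v t : porbit s t != C -> mate (upd r C v) t = mate r t.
Proof. by move=> /negPf tC; rewrite /mate updE tC. Qed.

Lemma roots_valid_upd r C v :
  roots_valid r -> C \in porbits s -> v \in C -> roots_valid (upd r C v).
Proof.
move=> /forallP rok CP vC; apply/forallP => t; rewrite updE; case: eqP => [->//|_]; exact: rok.
Qed.

(** Moving the root of one odd cycle changes the matching only there. As [q] drops that part, the
    first two conditions do not depend on [v]. *)
Lemma proper_upd p r c v x : roots_valid r -> v \in porbit s c -> odd (len c) ->
  let q t := if t \in porbit s c then t else mate r t in
  proper p (upd r (porbit s c) v) x =
  [&& alternatesb p x, alternatesb q x & rooted_ok (map x (traject s v (len c)))].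
Proof.
move=> rok vc lo q; have vE := mem_porbitE vc.
rewrite /proper; case: (alternatesb p x) => //=.
pose r' := upd r (porbit s c) v.
have r'v : r' (porbit s v) = v by rewrite /r' updE vE eqxx.
have El : len c = len v by rewrite vE.
rewrite El in lo *; have okP := @rooted_okP r' v x r'v lo.
apply/alternatesP/andP => [H|[/alternatesP Hq /okP Hr] t].
  split; last by apply/okP => t _; exact: H.
  apply/alternatesP => t; rewrite /q; case: ifP => // tv.
  rewrite -(mate_upd_out (C := porbit s c) r v); first exact: H.
  by apply: contraFneq tv => <-; rewrite porbit_id.
case: (boolP (t \in porbit s v)) => [tv|tv]; first exact: Hr.
rewrite mate_upd_out => [|]; first by have := Hq t; rewrite /q -vE (negPf tv).
by apply: contraNneq tv; rewrite -vE => <-; rewrite porbit_id.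
Qed.

Lemma root_predecessor v : 0 < len v -> last v (traject s (s v) (len v).-1) = (s^-1)%g v.
Proof.
move=> l0; apply: (@perm_inj _ s); rewrite permKV last_traject -iterS.
by rewrite prednK // iter_len.
Qed.

Lemma rooted_badE r v x : r (porbit s v) = v -> 2 < len v ->
  rooted_bad (map x (traject s v (len v))) =
  bad r (porbit s v) x && rooted_ok (map x (traject s v (len v))).
Proof.
move=> rv lv; rewrite /bad rv -root_predecessor ?(ltnW (ltnW lv)) //.
case: (len v) lv => [|[|[|n]]] // _; rewrite [in rooted_bad _]/= /rooted_bad /= -andbA.
by rewrite last_map.
Qed.

Lemma sum_porbit c (g : T -> nat) : \sum_(v in porbit s c) g v = \sum_(k < len c) g (iter k s c).
Proof.
rewrite (eq_bigl (mem (traject s c (len c)))); last first.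
  by move=> v; rewrite /= porbit_traject.
rewrite -big_uniq ?uniq_traject_porbit //= (big_nth c) size_traject big_mkord.
by apply: eq_bigr => k _; rewrite nth_traject.
Qed.

Lemma num_roots_traject (f : pred (seq bool)) c (x : T -> bool) :
  num_roots f (map x (traject s c (len c))) =
  \sum_(v in porbit s c) f (map x (traject s v (len c))).
Proof.
rewrite sum_porbit /num_roots size_map size_traject -sum1_count big_mkcond /=.
rewrite -[iota 0 _]/(iota 0 _) -{1}[len c]subn0 -/(index_iota 0 _) big_mkord.
apply: eq_bigr => k _; rewrite -map_rot rot_traject ?iter_len ?(ltnW (ltn_ord k)) //.
Qed.

Variable p : T -> T.
Hypotheses (pK : involutive p) (pN : forall t, p t <> t).

(** With the other roots fixed, the vertices of this cycle are fixed points of [q], hence ends of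
    strands, and [average] applies; rotations of the word correspond to choices of the root. *)
Lemma cycle_average r c : roots_valid r -> odd (len c) -> 2 < len c ->
  check_length (len c) ->
  10 * (\sum_(v in porbit s c) \sum_(x | proper p (upd r (porbit s c) v) x)
          bad (upd r (porbit s c) v) (porbit s c) x)
  <= len c * (\sum_(v in porbit s c) #|[pred x | proper p (upd r (porbit s c) v) x]|).
Proof.
move=> rok lo l2 chk; set C := porbit s c.
pose q t := if t \in C then t else mate r t.
have qK : involutive q.
  move=> t; rewrite /q; case tC: (t \in C); rewrite ?tC // ifF ?mateK //.
  by apply: contraFF tC => mC; rewrite /C -(mem_porbitE mC) porbit_mate porbit_id.
pose X (x : {ffun T -> bool}) := alternatesb p x && alternatesb q x.
pose w v (x : {ffun T -> bool}) := map x (traject s v (len c)).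
have rw (f : pred (seq bool)) : \sum_(x | X x) num_roots f (w c x) =
    \sum_(v in C) \sum_(x | X x) f (w v x).
  rewrite exchange_big /=; apply: eq_bigr => x _; exact: num_roots_traject.
have := @average _ p q pK qK pN (traject s c (len c)) (uniq_traject_porbit s c).
rewrite size_traject => /(_ _ chk) avg.
have {avg} : 10 * (\sum_(v in C) \sum_(x | X x) rooted_bad (w v x)) <=
    len c * \sum_(v in C) \sum_(x | X x) rooted_ok (w v x).
  rewrite -!rw; apply: avg => t; rewrite -porbit_traject /q => ->; by [].
have E v x : v \in C -> proper p (upd r C v) x = X x && rooted_ok (w v x).
  by move=> vC; rewrite (proper_upd p x rok vC lo) /X andbA.
congr (_ <= _); congr (_ * _); apply: eq_bigr => v vC.
  rewrite [RHS]big_mkcond [LHS]big_mkcond; apply: eq_bigr => x _; rewrite E //.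
  case: (X x) => //=; have vE := mem_porbitE vC.
  have -> : rooted_bad (w v x) = bad (upd r C v) C x && rooted_ok (w v x).
    by have := @rooted_badE (upd r C v) v x; rewrite updE vE eqxx; apply.
  by case: rooted_ok; rewrite ?andbF ?andbT //; case: bad.
rewrite -sum1_card [RHS]big_mkcond [LHS]big_mkcond; apply: eq_bigr => x _.
by rewrite inE E //; case: (X x) => //=; case: rooted_ok.
Qed.
End Mate.

(** * Averaging over all roots and colourings *)

Section Averaging.
Variables (T : finType) (s : {perm T}) (p : T -> T).
Hypotheses (pK : involutive p) (pN : forall t, p t <> t).
Implicit Types (r : {ffun {set T} -> T}) (C : {set T}) (x : {ffun T -> bool}).

(** Resampling the root of one cycle: every valid choice arises once for each former root [r C],
    hence [#|C|] times. *)
Lemma sum_roots C (g : {ffun {set T} -> T} -> nat) : C \in porbits s ->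
  \sum_(r | roots_valid s r) \sum_(v in C) g (upd r C v) =
  #|C| * \sum_(r | roots_valid s r) g r.
Proof.
move=> CP; have rC r : roots_valid s r -> r C \in C.
  by case/imsetP: CP => t _ -> /forallP/(_ t).
have part h : \sum_(r | roots_valid s r) h r =
    \sum_(u in C) \sum_(r | roots_valid s r && (r C == u)) h r :> nat.
  by rewrite (partition_big (fun r : {ffun {set T} -> T} => r C) (mem C)) //; exact: rC.
rewrite exchange_big /= [in RHS]part.
under eq_bigr => v _ do rewrite part.
rewrite exchange_big /= -sum_nat_const; apply: eq_bigr => u uC; apply: eq_bigr => v vC.
rewrite (reindex_onto (fun r => upd r C u) (fun r => upd r C v)) /=; last first.
  by move=> r /andP[_ /eqP rCu]; apply/ffunP => D; rewrite !updE; case: eqP => // ->.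
have updd r : upd (upd r C u) C v = upd r C v.
  by apply/ffunP => D; rewrite !updE; case: eqP.
have updr r : (upd r C v == r) = (r C == v).
  apply/eqP/eqP => [<-|rv]; first by rewrite updE eqxx.
  by apply/ffunP => D; rewrite updE; case: eqP => // ->.
apply: eq_big => r; rewrite updd updr; last first.
  by case/andP=> _ /eqP rv; congr g; apply/eqP; rewrite updr rv.
rewrite updE !eqxx andbT andbC [RHS]andbC; case: eqP => //= rv.
apply/idP/idP => rok; last exact: roots_valid_upd.
have -> : r = upd (upd r C u) C v by rewrite updd; apply/esym/eqP; rewrite updr rv.
exact: roots_valid_upd.
Qed.

Definition long_odd C := [&& C \in porbits s, odd #|C| & 4 < #|C|].

Lemma long_odd_average C : long_odd C ->
  10 * (\sum_(r | roots_valid s r) \sum_(x | proper s p r x) bad s r C x) <=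
  #|C| * \sum_(r | roots_valid s r) #|[pred x | proper s p r x]|.
Proof.
(* From length 10 on the bound is trivial; the lengths 5, 7 and 9 are left to computation. *)
case/and3P=> CP lo l4; have [l10|l10] := leqP 10 #|C|.
  apply: (@leq_trans (10 * \sum_(r | roots_valid s r) #|[pred x | proper s p r x]|)); last first.
    by rewrite leq_mul2r l10 orbT.
  rewrite leq_mul2l /=; apply: leq_sum => r _; rewrite -sum1_card.
  by apply: leq_sum => x _; case: bad.
case/imsetP: (CP) => c _ CE.
have chk : check_length #|C|.
  have : [|| #|C| == 5, #|C| == 7 | #|C| == 9] by lia.
  by case/or3P=> /eqP->; vm_compute.
have C0 : 0 < #|C| by lia.
rewrite -(leq_pmul2l C0) mulnCA.
rewrite -(sum_roots (fun r => \sum_(x | proper s p r x) bad s r C x) CP).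
rewrite -(sum_roots (fun r => #|[pred x | proper s p r x]|) CP).
rewrite !big_distrr /=; apply: leq_sum => r rok; rewrite CE in lo l4 chk *.
apply: cycle_average => //; lia.
Qed.

Lemma exists_few_bad : T -> exists r x, [/\ roots_valid s r, proper s p r x &
  10 * \sum_(C | long_odd C) bad s r C x <= \sum_(C | long_odd C) #|C|].
Proof.
move=> t0; set S := \sum_(C | long_odd C) #|C|.
pose N := \sum_(r | roots_valid s r) #|[pred x | proper s p r x]|.
have le : 10 * (\sum_(r | roots_valid s r) \sum_(x | proper s p r x)
      \sum_(C | long_odd C) bad s r C x) <= S * N.
  under eq_bigr => r _ do rewrite exchange_big /=.
  rewrite exchange_big /= big_distrr big_distrl /=; apply: leq_sum => C; exact: long_odd_average.
have N_gt0 : 0 < N.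
  pose r : {ffun {set T} -> T} := [ffun C : {set T} => odflt t0 [pick t in C]].
  have rok : roots_valid s r.
    apply/forallP => t; rewrite ffunE; case: pickP => // /(_ t).
    by rewrite porbit_id.
  have [x [xp xq]] := two_involutions pK (mateK rok).
  rewrite /N (bigD1 r) //= addn_gt0; apply/orP; left; apply/card_gt0P.
  exists [ffun t => x t]; rewrite inE /proper; apply/andP; split; apply/alternatesP => t ft.
    by rewrite !ffunE xp.
  by rewrite !ffunE xq.
case: (boolP [exists r, exists x, [&& roots_valid s r, proper s p r x &
    10 * \sum_(C | long_odd C) bad s r C x <= S]]).
  by case/existsP=> r /existsP[x /and3P[? ? ?]]; exists r, x.
rewrite negb_exists => /forallP none; exfalso.
suff : S.+1 * N <= S * N by rewrite leq_mul2r ltnn orbF eqn0Ngt N_gt0.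
apply: leq_trans le; rewrite /N !big_distrr /=; apply: leq_sum => r rok.
rewrite -sum1_card !big_distrr /=; apply: leq_sum => x xok; rewrite muln1.
have := none r; rewrite negb_exists => /forallP/(_ x); rewrite rok /= ltnNge.
by rewrite inE /= in xok; rewrite xok.
Qed.
End Averaging.

(** * Four colours from a good choice of roots *)

(** Each fibre is identified with the Klein four-group, [p] and [f] being translations by two
    generators. *)
Lemma klein_fibres (T : finType) (q : nat) (k : T -> 'I_q) : T ->
  (forall j, #|[set t | k t == j]| = 4) ->
  exists p f : T -> T, [/\ involutive p, involutive f, forall t, p (f t) = f (p t),
    forall t, [/\ p t <> t, f t <> t & f t <> p t] &
    forall t u, k t = k u -> [\/ u = t, u = p t, u = f t | u = p (f t)]].
Proof.
move=> t0 /(@fibre_enum _ _ 3 k t0)[e [K [eP Pe Ke]]].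
pose a (l : 'I_4) : 'I_4 := inord (nth 0 [:: 1; 0; 3; 2] l).
pose b (l : 'I_4) : 'I_4 := inord (nth 0 [:: 2; 3; 0; 1] l).
have I4 (P : pred 'I_4) : all (fun n => P (inord n)) (iota 0 4) -> forall l, P l.
  by move=> /allP H l; rewrite -(inord_val l) H // mem_iota /=.
pose lift (h : 'I_4 -> 'I_4) t := e (k t) (h (K t)).
have liftE h t : K (lift h t) = h (K t) /\ k (lift h t) = k t by rewrite Ke Pe.
have lift2 h h' t : lift h (lift h' t) = e (k t) (h (h' (K t))).
  by rewrite {1}/lift Ke Pe.
have ab l : [&& a (a l) == l, b (b l) == l, a (b l) == b (a l), a l != l, b l != l & b l != a l].
  pose P l := [&& a (a l) == l, b (b l) == l, a (b l) == b (a l), a l != l, b l != l & b l != a l].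
  rewrite -/(P l); apply: (I4 _).
  by rewrite /= /P /a /b /= -!(inj_eq val_inj) /= !inordK //= ?inordK //= ?inordK.
have four l l' : [|| l' == l, l' == a l, l' == b l | l' == a (b l)].
  pose P l l' := [|| l' == l, l' == a l, l' == b l | l' == a (b l)].
  rewrite -/(P l l'); move: l'; apply: (I4 _); move: l.
  apply: (I4 (fun l => all (fun n => P l (inord n)) (iota 0 4))).
  by rewrite /= /P /a /b /= -!(inj_eq val_inj) /= !inordK //= ?inordK //= ?inordK.
have fix_l h t : lift h t = t -> h (K t) = K t by move/(congr1 K); rewrite Ke.
exists (lift a), (lift b); split=> [t|t|t|t|t u tu].
- by rewrite lift2; have /and5P[/eqP-> _ _ _ _] := ab (K t); rewrite eP.
- by rewrite lift2; have /and5P[_ /eqP-> _ _ _] := ab (K t); rewrite eP.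
- by rewrite !lift2; have /and5P[_ _ /eqP-> _ _] := ab (K t).
- have /and5P[_ _ _ aN /andP[bN baN]] := ab (K t); split.
  + by move/fix_l/eqP; rewrite (negPf aN).
  + by move/fix_l/eqP; rewrite (negPf bN).
  by move/(congr1 K); rewrite !Ke => /eqP; rewrite (negPf baN).
rewrite -[u]eP -tu; case/or4P: (four (K t) (K u)) => /eqP->.
- by constructor 1; rewrite eP.
- by constructor 2.
- by constructor 3.
by constructor 4; rewrite lift2.
Qed.

Section FromRoots.
Variables (T : finType) (q : nat) (k : T -> 'I_q) (s : {perm T}).

Lemma colour_but_few : T -> (forall j, #|[set t | k t == j]| = 4) ->
  exists (Z : {set T}) (c : T -> bool * bool),
    10 * #|Z| <= \sum_(C | long_odd s C) #|C| /\
    forall t u, t \notin Z -> u \notin Z -> t != u ->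
      k t = k u \/ u = s t -> c t != c u.
Proof.
move=> t0 /(klein_fibres t0)[p [f [pK fK pf pfN kP]]].
have pN t : p t <> t by have [] := pfN t.
have [r [x [rok /andP[/alternatesP xp /alternatesP xm] few]]] := exists_few_bad s pK pN t0.
pose Z := [set r C | C in [set C | long_odd s C && bad s r C x]].
have Zle : 10 * #|Z| <= \sum_(C | long_odd s C) #|C|.
  apply: leq_trans few; rewrite leq_mul2l /=; apply: leq_trans (leq_imset_card _ _) _.
  rewrite -sum1_card big_mkcond [leqRHS]big_mkcond; apply: leq_sum => C _.
  by rewrite inE; case: long_odd => //=; case: bad.
pose mono t := [&& x (s t) == x t, t \notin Z, s t \notin Z & s t != t].
have monoN t : mono t -> ~~ mono (s t).
  case/and4P=> /eqP x1 tZ sZ st; apply/negP => /and4P[/eqP x2 _ ssZ ss].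
  set u := s t in x1 x2 sZ ss ssZ st.
  have tu : (s^-1)%g u = t by rewrite /u permK.
  (* The mate of [u] is [u] or a neighbour, and both neighbours share its colour; so [u] is
     unmatched, that is, the root of an odd cycle. *)
  have : mate s r u = u.
    apply/eqP; apply: contraT => /eqP mu; have := xm _ mu.
    rewrite /mate; case: ifP => _; first by rewrite x2; case: (x u).
    rewrite tu; case: ifP => [_|_]; last by rewrite -x1; case: (x u).
    by case: (x u).
  have [v [n [rv vE nl uE]]] := root_porbit u rok.
  have su : s u <> u by apply/eqP.
  rewrite {1}uE mate_iter //; case: ifP => [_|ne]; first by rewrite iterS -uE.
  case: n uE nl ne => [|n] uE nl ne; last by move=> E; apply: su; rewrite -{1}E -iterS -uE.
  rewrite /= in uE; rewrite -uE in rv nl vE *; case: ifP => lo; last first.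
    move=> E; apply: su; rewrite -{1}E -iterS prednK //; exact: iter_len.
  (* A longer odd cycle has its bad root in [Z]; in a triangle the other two vertices are mates and
     so differ in colour. *)
  case: (ltngtP #|porbit s u| 3) => [l3|l3|l3] _.
  - apply: su; have := iter_len s u.
    by case: #|_| l3 lo => [|[|[|]]].
  - have : u \in Z; last by rewrite (negPf sZ).
    apply/imsetP; exists (porbit s u); last by rewrite rv.
    rewrite inE /long_odd imset_f // lo /bad rv tu -x1 x2 eqxx /= andbT.
    by rewrite ltn_neqAle l3 andbT; apply: contraTneq lo => <-.
  have u3 : iter 3 s u = u by rewrite -l3 iter_len.
  have ut : s (s u) = t by apply: (@perm_inj _ s); exact: u3.
  have m1 : mate s r (s u) = t by rewrite (@mate_iter _ s r u 1) ?l3.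
  have tsu : t <> s u by rewrite -ut => /perm_inj.
  by have := xm (s u); rewrite m1 => /(_ tsu); rewrite x2 x1; case: (x t).
have monoV t : mono t -> ~~ mono ((s^-1)%g t).
  by move=> mt; apply: contraL mt => /monoN; rewrite permKV.
pose g t := if mono t then s t else if mono ((s^-1)%g t) then (s^-1)%g t else t.
have gK : involutive g.
  move=> t; rewrite /g; case mt: (mono t); first by rewrite (negPf (monoN _ mt)) permK mt.
  by case mt': (mono (s^-1%g t)); rewrite ?mt' ?permKV ?mt ?mt'.
(* As [x] splits each [p]-pair, exactly one of [f t] and [p (f t)] has the colour of [t]: the colour
   classes of a fibre are the pairs of [p2]. *)
pose p2 t := if x (f t) == x t then f t else p (f t).
have xpN t : x (p t) = ~~ x t by apply: xp; exact: pN.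
have p2K : involutive p2.
  move=> t; rewrite /p2; case xf: (x (f t) == x t); first by rewrite fK eq_sym xf.
  rewrite -pf fK pK !xpN; case: eqP => // H.
  by move/eqP: xf => []; move: H; case: (x t) (x (f t)) => [] [].
have p2N t : p2 t <> t.
  have [p1 p3 p4] := pfN t; rewrite /p2; case: ifP => _ // E.
  by case: p4; rewrite -[in RHS]E pK.
have [y [yp yg]] := two_involutions p2K gK.
exists Z, (fun t => (x t, y t)); split=> // t u tZ uZ tu.
rewrite xpair_eqE negb_and -implybE.
case=> [/kP|us]; last first.
  rewrite us in uZ tu *; apply/implyP => /eqP xst; have mt : mono t.
    by rewrite /mono xst eqxx tZ uZ eq_sym tu.
  have := yg t; rewrite /g mt => ->; first by case: (y t).
  by case/and4P: mt => _ _ _ /eqP.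
case=> [E|->|->|->]; rewrite ?E ?eqxx // in tu *.
- by rewrite xpN; case: (x t).
- apply/implyP => /eqP xe; have := yp t (p2N t); rewrite /p2 -xe eqxx => ->.
  by case: (y t).
apply/implyP => /eqP; rewrite xpN => xe; have := yp t (p2N t); rewrite /p2.
by case: eqP xe => [->|_ _ ->]; [case: (x t)|case: (y t)].
Qed.
End FromRoots.

(** * Independent transversals *)

Lemma first_split (T : Type) (a : pred T) (s : seq T) : has a s ->
  exists ys y zs, [/\ s = ys ++ y :: zs, a y & ~~ has a ys].
Proof. by case/split_find => y ys zs ay nys; exists ys, y, zs; rewrite cat_rcons. Qed.

Section Transversal.
Variables (T : finType) (e : rel T) (q : nat) (k : T -> 'I_q).
Hypotheses (e_sym : symmetric e) (e_irr : irreflexive e).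
Implicit Types (I J : {set T}) (A : {set 'I_q}) (t u x y w : T).

Definition transversal A I : bool :=
  [&& [forall j in A, #|[set t in I | k t == j]| == 1], [forall t in I, k t \in A]
    & [forall t in I, forall u in I, ~~ e t u]].

Lemma transversalP A I : reflect
  [/\ forall j, j \in A -> exists2 t, t \in I & k t = j,
      forall t u, t \in I -> u \in I -> k t = k u -> t = u,
      forall t, t \in I -> k t \in A
    & forall t u, t \in I -> u \in I -> ~~ e t u] (transversal A I).
Proof.
apply: (iffP and3P) => [[/forall_inP one /forall_inP sub /forall_inP ind]|[ex uni sub ind]].
  split=> // [j jA|t u tI uI ktu|t u tI uI].
  - have : 0 < #|[set t in I | k t == j]| by rewrite (eqP (one j jA)).
    by case/card_gt0P => t; rewrite inE => /andP[tI /eqP kt]; exists t.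
  - have /cards1P[w wE] := one _ (sub t tI).
    have : t \in [set w] by rewrite -wE inE tI eqxx.
    have : u \in [set w] by rewrite -wE inE uI ktu eqxx.
    by rewrite !inE => /eqP-> /eqP->.
  by have /forall_inP := ind t tI; apply.
split; apply/forall_inP => //.
  move=> j /ex[t tI kt]; apply/cards1P; exists t; apply/setP => u; rewrite !inE.
  by apply/andP/eqP => [[uI /eqP ku]|->]; [apply: uni; rewrite ?ku|rewrite kt].
by move=> t tI; apply/forall_inP => u uI; exact: ind.
Qed.

Let N x := [set u | e x u].

Lemma inN x u : (u \in N x) = e x u. Proof. by rewrite inE. Qed.

Definition dominated (xs : seq T) I := [set t in I | has (e^~ t) xs].

(* The neighbourhoods of [xs] in [I] are lexicographically as small as possible. *)
Definition lex_min A (xs : seq T) I : Prop :=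
  forall ys x zs J, xs = ys ++ x :: zs -> transversal A J ->
    {in ys, forall y, N y :&: J = N y :&: I} -> #|N x :&: I| <= #|N x :&: J|.

Variable d : nat.
Hypothesis d_gt0 : 0 < d.
Hypothesis deg : forall t, #|N t| <= d.
Hypothesis size_fibre : forall j, 2 * d <= #|[set t | k t == j]|.

Lemma card_has (xs : seq T) : #|[set t | has (e^~ t) xs]| <= d * size xs.
Proof.
elim: xs => [|x xs IH] /=.
  by rewrite muln0 leqn0 cards_eq0; apply/eqP/setP => t; rewrite !inE.
rewrite (_ : [set _ | _] = N x :|: [set t | has (e^~ t) xs]); last first.
  by apply/setP => t; rewrite !inE.
rewrite mulnS; apply: leq_trans (leq_card_setU _ _) _; exact: leq_add.
Qed.

(** The fibre of [j0] and those of the dominated set [W] have at least [2 * d * (#|W| + 1)]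
    vertices, while the neighbours of [xs] and [W] number at most [2 * d * #|W|]. *)
Lemma undominated A j0 xs I : j0 \notin A -> transversal A I ->
  size xs <= #|dominated xs I| ->
  exists x, [/\ k x = j0 \/ exists2 w, w \in dominated xs I & k x = k w,
    ~~ has (e^~ x) xs & forall w, w \in dominated xs I -> ~~ e w x].
Proof.
move=> j0A /transversalP[ex uni sub ind] szW; set W := dominated xs I in szW *.
have WI w : w \in W -> w \in I by rewrite inE => /andP[].
pose S := j0 |: k @: W.
have cardS : #|S| = #|W|.+1.
  rewrite cardsU1 card_in_imset; last by move=> t u /WI tI /WI uI; exact: uni.
  suff -> : j0 \notin k @: W by [].
  by apply/imsetP => -[w /WI/sub wA E]; rewrite E wA in j0A.
pose D := [set t | has (e^~ t) xs] :|: [set t | has (e^~ t) (enum W)].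
have cardD : #|D| <= 2 * d * #|W|.
  apply: leq_trans (leq_card_setU _ _) _.
  have := card_has xs; have := card_has (enum W); rewrite -cardE; nia.
have cardU : 2 * d * #|S| <= #|[set t | k t \in S]|.
  rewrite mulnC -sum_nat_const -sum1_card.
  rewrite (partition_big k (mem S)) /=; last by move=> t; rewrite inE.
  apply: leq_sum => j jS; apply: leq_trans (size_fibre j) _.
  rewrite -sum1_card; apply: eq_leq; apply: eq_bigl => t; rewrite !inE.
  by case: eqP => [->|]; rewrite ?andbF // andbT; move: jS; rewrite !inE.
have : ~~ ([set t | k t \in S] \subset D).
  apply/negP => /subset_leq_card; rewrite cardS in cardU; nia.
case/subsetPn => x; rewrite !inE negb_or => kx /andP[xs0 W0]; exists x; split=> //.
  case/orP: kx => [/eqP->|/imsetP[w wW E]]; [by left|by right; exists w].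
move=> w wW; apply: contra W0 => wx; apply/hasP; exists w; rewrite // mem_enum //.
Qed.

Lemma transversal_swap A I x w : transversal A I -> w \in I -> k x = k w ->
  N x :&: I = set0 -> transversal A (x |: (I :\ w)).
Proof.
move=> /transversalP[ex uni sub ind] wI kx N0.
have xI u : u \in I -> ~~ e x u.
  move=> uI; apply/negP => xu; have : u \in N x :&: I by rewrite !inE xu.
  by rewrite N0 inE.
apply/transversalP; split=> [j /ex[t tI <-]|t u|t|t u]; rewrite ?inE.
- case: (t =P w) => [->|/eqP tw]; first by exists x; rewrite ?inE ?eqxx.
  by exists t; rewrite // !inE tw tI orbT.
- case/orP=> [/eqP->|/andP[tw tI]] /orP[/eqP->|/andP[uw uI]] //.
  + by move=> E; case/eqP: uw; apply: uni; rewrite // -E.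
  + by move=> E; case/eqP: tw; apply: uni; rewrite // E.
  + exact: uni.
- by case/orP=> [/eqP->|/andP[_ /sub]]; rewrite // kx; apply: sub.
case/orP=> [/eqP->|/andP[tw tI]] /orP[/eqP->|/andP[uw uI]]; rewrite ?e_irr ?xI //.
  by rewrite e_sym xI.
exact: ind.
Qed.

Lemma transversal_add A I x : transversal A I -> k x \notin A ->
  N x :&: I = set0 -> transversal (k x |: A) (x |: I).
Proof.
move=> /transversalP[ex uni sub ind] kx N0.
have xI u : u \in I -> ~~ e x u.
  move=> uI; apply/negP => xu; have : u \in N x :&: I by rewrite !inE xu.
  by rewrite N0 inE.
apply/transversalP; split=> [j|t u|t|t u]; rewrite ?inE.
- case/orP=> [/eqP->|/ex[t tI <-]]; first by exists x; rewrite ?inE ?eqxx.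
  by exists t; rewrite // inE tI orbT.
- case/orP=> [/eqP->|tI] /orP[/eqP->|uI] // E.
  + by rewrite E sub in kx.
  + by rewrite -E sub in kx.
  + exact: uni.
- by case/orP=> [/eqP->|/sub ->]; rewrite ?eqxx ?orbT.
case/orP=> [/eqP->|tI] /orP[/eqP->|uI]; rewrite ?e_irr ?xI //.
  by rewrite e_sym xI.
exact: ind.
Qed.

Lemma dominated_eq xs I J : {in xs, forall y, N y :&: J = N y :&: I} ->
  dominated xs J = dominated xs I.
Proof.
move=> eqN; apply/setP => t; rewrite !inE.
have E y : y \in xs -> e y t -> (t \in J) = (t \in I).
  by move=> yx yt; have /setP/(_ t) := eqN y yx; rewrite !in_setI !inN yt.
by apply/andP/andP => -[tI /hasP[y yx yt]]; (split; [|by apply/hasP; exists y]);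
  move: tI; rewrite (E y).
Qed.

(** The new [J] minimises [#|N x :&: J|] among the transversals unchanged around [xs]. If this were
    0, then [x] could be added to [J], or replace the vertex [w] of its fibre, contradicting the
    second hypothesis or the minimality of [I]. *)
Lemma grow A j0 xs I : j0 \notin A -> (forall J, ~~ transversal (j0 |: A) J) ->
  transversal A I -> lex_min A xs I -> size xs <= #|dominated xs I| ->
  exists x J, [/\ transversal A J, lex_min A (rcons xs x) J
    & size (rcons xs x) <= #|dominated (rcons xs x) J|].
Proof.
move=> j0A none It Imin szW.
have [x [kx xxs xW]] := undominated j0A It szW.
pose P J := transversal A J && [forall y in xs, N y :&: J == N y :&: I].
have PI : P I by rewrite /P It; apply/forall_inP.
case: (@arg_minnP _ I P (fun J => #|N x :&: J|) PI) => J /andP[Jt /forall_inP JI] Jmin.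
have {}JI : {in xs, forall y, N y :&: J = N y :&: I} by move=> y /JI/eqP.
have WE := dominated_eq JI.
have Jlex : lex_min A (rcons xs x) J.
  move=> ys y zs K; case: (lastP zs) => [|zs' z].
    rewrite cats1 => /rcons_inj[<- <-] Kt KJ; apply: Jmin.
    by rewrite /P Kt; apply/forall_inP => z zx; rewrite KJ // JI.
  rewrite -rcons_cons -rcons_cat => /rcons_inj[E _] Kt KJ.
  have inx v : v \in ys -> v \in xs by move=> vy; rewrite E mem_cat vy.
  rewrite JI ?E ?mem_cat ?inE ?eqxx ?orbT //; apply: (Imin _ _ _ _ E Kt) => v vy.
  by rewrite KJ // JI ?inx.
exists x, J; split=> //.
have ne : N x :&: J != set0.
  apply/eqP => N0; case: kx => [kx|[w wW kx]].
    by have := none (x |: J); rewrite -kx transversal_add // kx.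
  have wJ : w \in J by move: wW; rewrite -WE inE => /andP[].
  have := wW; rewrite inE => /andP[_].
  (* Taking the first [y] adjacent to [w] leaves the earlier neighbourhoods intact, while the
     exchange of [w] for [x] shrinks that of [y]. *)
  case/first_split => ys [y [zs [E yw nys]]].
  have yxs : y \in xs by rewrite E mem_cat mem_head orbT.
  have ysxs z : z \in ys -> z \in xs by move=> zy; rewrite E mem_cat zy.
  have xN v : v \in xs -> e v x = false.
    by move=> vx; apply: contraNF xxs => vx'; apply/hasP; exists v.
  pose K := x |: (J :\ w).
  have Kt : transversal A K by apply: transversal_swap.
  have : #|N y :&: I| <= #|N y :&: K|.
    apply: (Imin ys y zs K E Kt) => z zy; rewrite -JI ?ysxs //; apply/setP => t; rewrite !inE.
    case: (t =P x) => [->|_] /=; first by rewrite xN ?ysxs.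
    case: (t =P w) => [->|_] //=; rewrite andbF.
    by apply/esym/negbTE; apply: contra nys => /andP[zw _]; apply/hasP; exists z.
  rewrite -JI // leqNgt => /negP[]; apply: proper_card; apply/properP; split.
    apply/subsetP => t; rewrite !inE => /andP[yt /orP[/eqP tx|/andP[_ ->]]]; last by rewrite yt.
    by rewrite tx xN in yt.
  exists w; rewrite !inE ?yw ?wJ // eqxx orbF; apply/eqP => wx.
  by rewrite wx xN in yw.
have disj : [disjoint dominated xs J & N x :&: J].
  rewrite WE -setI_eq0; apply/eqP/setP => t; rewrite in_setI [RHS]inE; apply/negP => /andP[tW].
  by rewrite !inE e_sym (negPf (xW _ tW)).
have -> : dominated (rcons xs x) J = dominated xs J :|: (N x :&: J).
  by apply/setP => t; rewrite !inE has_rcons orbC andb_orr [e x t && _]andbC.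
move: disj; rewrite -setI_eq0 cardsU => /eqP->; rewrite cards0 subn0 size_rcons.
by rewrite WE -addn1 leq_add // card_gt0.
Qed.

(* Haxell's theorem.  The sequence [xs] of [grow] could be prolonged forever. *)
Theorem exists_transversal : exists I, transversal [set: 'I_q] I.
Proof.
suff H n A : #|A| = n -> exists I, transversal A I by exact: H.
elim: n A => [|n IH] A cA.
  exists set0; apply/transversalP; rewrite (cards0_eq cA).
  by split=> [j|t u|t|t u]; rewrite inE.
have /card_gt0P[j0 j0A] : 0 < #|A| by rewrite cA.
have j0N : j0 \notin A :\ j0 by rewrite !inE eqxx.
have [I It] : exists I, transversal (A :\ j0) I.
  by apply: IH; move: cA; rewrite (cardsD1 j0) j0A => -[].
case: (boolP [exists J, transversal (j0 |: A :\ j0) J]) => [/existsP|].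
  by rewrite setD1K.
rewrite negb_exists => /forallP none.
(* A sequence with more than [#|T|] terms would dominate more than [#|T|] vertices. *)
suff [xs [J [_ _ szW xsn]]] : exists xs J, [/\ transversal (A :\ j0) J, lex_min (A :\ j0) xs J,
    size xs <= #|dominated xs J| & size xs = #|T|.+1].
  by have := max_card (mem (dominated xs J)); rewrite leqNgt -xsn szW.
elim: (#|T|.+1) => [|m [xs [J [Jt Jlex szW xsm]]]].
  by exists [::], I; split=> // [[]].
have [x [K [Kt Klex szK]]] := grow j0N none Jt Jlex szW.
by exists (rcons xs x), K; split; rewrite // size_rcons xsm.
Qed.
End Transversal.

(** * Transversals meeting most cycles *)

Definition cycle_adj (T : finType) (s : {perm T}) : rel T :=
  fun t u => (t != u) && ((u == s t) || (t == s u)).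

Section Exchange.
Variables (T : finType) (s : {perm T}) (q : nat) (k : T -> 'I_q).
Implicit Types (I : {set T}) (C D : {set T}) (t u : T).

Notation adj := (cycle_adj s).
Notation transv := (transversal adj k [set: 'I_q]).

Lemma cycle_adj_sym : symmetric adj.
Proof. by move=> t u; rewrite /cycle_adj eq_sym orbC. Qed.

Lemma cycle_adj_irr : irreflexive adj.
Proof. by move=> t; rewrite /cycle_adj eqxx. Qed.

Lemma cycle_adj_porbit t u : adj t u -> porbit s t = porbit s u.
Proof.
case/andP=> _ /orP[]/eqP->; apply/eqP; rewrite eq_porbit_mem.
  by rewrite porbit_sym (mem_porbit s 1).
exact: (mem_porbit s 1).
Qed.

Lemma porbits_eq C t : C \in porbits s -> (t \in C) = (porbit s t == C).
Proof. by case/imsetP => c _ ->; rewrite eq_porbit_mem. Qed.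

Definition unhit I := [set C in porbits s | (2 < #|C|) && [disjoint C & I]].
(** The cycles that can lose a vertex of [I] without becoming unhit. *)
Definition rich I C := (#|C| <= 2) || (1 < #|C :&: I|).
Definition step I : rel {set T} := fun C D =>
  [&& C \in porbits s, D \in porbits s & [exists r in C, exists i in I :&: D, k i == k r]].

Lemma path_imp (U : eqType) (e e' : rel U) x w :
  (forall y z, z \in w -> e y z -> e' y z) -> path e x w -> path e' x w.
Proof.
elim: w x => //= y w IH x H /andP[xy yw]; rewrite H ?mem_head //=.
by apply: IH yw => z v vw; apply: H; rewrite inE vw orbT.
Qed.

(* Exchanging [i] for [r] in the first step moves the defect from [C0] to [C1]; the
   remaining steps stay valid because the cycles on the path are distinct. *)
Lemma improve w C0 I : transv I -> path (step I) C0 w -> uniq (C0 :: w) ->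
  C0 \in unhit I -> rich I (last C0 w) ->
  exists2 J, transv J & #|unhit J| < #|unhit I|.
Proof.
elim: w C0 I => [|C1 w IH] C0 I It.
  rewrite /= inE => _ _ /and3P[_ C2 dis]; rewrite /rich leqNgt C2 /=.
  by move: dis; rewrite -setI_eq0 => /eqP->; rewrite cards0.
rewrite [path _ _ _]/= => /andP[st pw] U01 C0U ri.
have [C01 C0w C1w Uw] : [/\ C0 != C1, C0 \notin w, C1 \notin w & uniq w].
  by move: U01; rewrite /= inE negb_or => /andP[/andP[-> ->] /andP[-> ->]].
have /and3P[C0P C1P /existsP[r /andP[rC0 /existsP[i /andP[iIC /eqP kir]]]]] := st.
have [iI iC1] : i \in I /\ i \in C1 by move: iIC; rewrite inE => /andP.
have C0I u : u \in C0 -> u \notin I.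
  move=> uC; move: C0U; rewrite inE => /and3P[_ _ dis].
  by apply/negP => uI; rewrite (disjointFr dis uC) in uI.
pose J := r |: (I :\ i).
have Jt : transv J.
  apply: transversal_swap; [exact: cycle_adj_sym|exact: cycle_adj_irr|exact: It|exact: iI|by []|].
  apply/setP => u; rewrite !inE; apply/negP => /andP[/cycle_adj_porbit E].
  by apply/negP/C0I; rewrite porbits_eq // -E -porbits_eq.
have out D : D \in porbits s -> D != C0 -> D != C1 -> D :&: J = D :&: I.
  move=> DP D0 D1; apply/setP => u; rewrite !inE; case uD : (u \in D) => //=.
  have uE : porbit s u = D by apply/eqP; rewrite -porbits_eq.
  case: (u =P r) => [ur|_] /=.
    by move: rC0; rewrite porbits_eq // -ur uE (negPf D0).
  by case: (u =P i) => //= ui; move: iC1; rewrite porbits_eq // -ui uE (negPf D1).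
have wP D : D \in w -> D \in porbits s.
  elim: (w) (C1) pw => //= D' w' IHw C' /andP[/and3P[_ D'P _] pw].
  by rewrite inE => /orP[/eqP->//|]; exact: IHw pw.
have unhitJ D : D != C1 -> (D \in unhit J) = (D != C0) && (D \in unhit I).
  move=> D1; case: (D =P C0) => [->|/eqP D0] /=.
    rewrite inE -setI_eq0; apply/negbTE/and3P => -[_ _ /eqP/setP/(_ r)].
    by rewrite !inE rC0 eqxx.
  by rewrite !inE; case DP: (D \in porbits s) => //=; rewrite -!setI_eq0 out.
have C1I : C1 \notin unhit I.
  by rewrite inE C1P /=; apply/negP => /andP[_ dis]; rewrite (disjointFr dis iC1) in iI.
have cardD : #|unhit I :\ C0| < #|unhit I|.
  by apply: proper_card; apply: properD1.
case: (boolP (rich I C1)) => [r1|].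
  exists J => //; apply: leq_ltn_trans cardD; apply: subset_leq_card.
  apply/subsetP => D; case: (D =P C1) => [->|/eqP D1]; last by rewrite unhitJ // in_setD1.
  rewrite inE => /and3P[_ l2 dis]; move: r1; rewrite /rich leqNgt l2 /=.
  rewrite (cardsD1 i) inE iC1 iI => /card_gt0P[u]; rewrite !inE => /and3P[ui uC uI].
  by have := disjointFr dis uC; rewrite !inE ui uI orbT.
rewrite /rich negb_or -leqNgt -ltnNge => /andP[l2 I1].
have C1J : C1 \in unhit J.
  rewrite inE C1P l2 /= -setI_eq0; apply/eqP/setP => u; rewrite !inE; apply/negP => /andP[uC].
  case/orP=> [/eqP ur|/andP[ui uI]].
    move: rC0; rewrite porbits_eq // -ur; move: uC.
    by rewrite porbits_eq // => /eqP->; rewrite eq_sym (negPf C01).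
  move: I1; rewrite (cardsD1 i) inE iC1 iI ltnS leqn0 cards_eq0 => /eqP/setP/(_ u).
  by rewrite !inE ui uC uI.
have cardJ : #|unhit J| <= #|unhit I|.
  apply: leq_trans cardD; rewrite (cardsD1 C1) C1J add1n ltnS subset_leq_card //.
  by apply/subsetP => D; rewrite !in_setD1 => /andP[D1]; rewrite unhitJ.
have pJ : path (step J) C1 w.
  apply: path_imp pw => D E Ew; rewrite /step => /and3P[-> -> /existsP[r' /andP[r'D H]]].
  apply/existsP; exists r'; rewrite r'D /=; case/existsP: H => i' H; apply/existsP; exists i'.
  suff -> : J :&: E = I :&: E by [].
  rewrite ![_ :&: E]setIC out ?wP //.
    by apply: contraNneq C0w => <-.
  by apply: contraNneq C1w => <-.
have riJ : rich J (last C1 w).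
  move: ri; rewrite /rich /=; case: w {IH pw U01 pJ} C0w C1w Uw wP => [|D w] C0w C1w Uw wP /=.
    by rewrite leqNgt l2 ltnNge I1.
  have lw : last D w \in D :: w by rewrite mem_last.
  rewrite out ?wP //; first by apply: contraNneq C0w => <-.
  by apply: contraNneq C1w => <-.
have [|K Kt lt] := IH C1 J Jt pJ _ C1J riJ; first by rewrite /= C1w.
by exists K => //; apply: leq_trans cardJ.
Qed.

Lemma card_in_porbits (R : {set {set T}}) (A : {set T}) : R \subset porbits s ->
  #|[set t in A | porbit s t \in R]| = \sum_(C in R) #|C :&: A|.
Proof.
move=> RP; rewrite -sum1_card (partition_big (porbit s) (mem R)) /=; last first.
  by move=> t; rewrite inE => /andP[].
apply: eq_bigr => C CR; rewrite -sum1_card; apply: eq_bigl => t; rewrite !inE.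
rewrite (porbits_eq t (subsetP RP C CR)) andbC andbCA andbC.
by case: eqP => [->|]; rewrite ?CR ?andbF.
Qed.

Hypothesis fibre4 : forall j, #|[set t | k t == j]| = 4.

(* At a minimum all cycles reachable from the unhit ones carry at most one vertex of
   [I], and the fibres that they meet have their vertex of [I] on them: with
   [R] such cycles, [u] of them unhit, they have at most [4 (R - u)] vertices,
   whereas only triangles have fewer than 4. *)
Lemma few_unhit : exists2 I, transv I &
  4 * #|unhit I| <= #|[set C in porbits s | #|C| == 3]|.
Proof.
(* Degree 2 and fibres of size [4 = 2 * 2] are within reach of Haxell's theorem. *)
have deg t : #|[set u | adj t u]| <= 2.
  apply: (@leq_trans #|[set s t; (s^-1)%g t]|); last by rewrite cards2; case: eqP.
  apply/subset_leq_card/subsetP => u; rewrite !inE => /andP[_].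
  by case/orP=> /eqP->; rewrite ?eqxx // permK eqxx orbT.
have [|I0 I0t] := @exists_transversal T adj q k cycle_adj_sym cycle_adj_irr 2 isT deg.
  by move=> j; rewrite fibre4.
case: (@arg_minnP _ I0 (fun I => transv I) (fun I => #|unhit I|) I0t) => I It Imin.
exists I => //.
pose R := [set C | [exists C0 in unhit I, connect (step I) C0 C]].
have Rpoor C : C \in R -> [/\ C \in porbits s, 2 < #|C| & #|C :&: I| <= (C \notin unhit I)].
  rewrite inE => /exists_inP[C0 C0U /connectP[w pw ->]].
  have [w' pw' uw' _] := shortenP pw; set D := last C0 w'.
  have nri : ~~ rich I D.
    apply/negP => ri; have [J Jt] := improve It pw' uw' C0U ri.
    by rewrite ltnNge Imin.
  have DP : D \in porbits s.
    rewrite /D; case: (lastP w') pw' => [|w1 E] /=; first by move: C0U; rewrite inE => /andP[].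
    by rewrite rcons_path last_rcons => /andP[_ /and3P[]].
  move: nri; rewrite /rich negb_or -ltnNge -leqNgt => /andP[l2 l1]; split=> //.
  case: (boolP (D \in unhit I)) => //=.
  by rewrite inE => /and3P[_ _]; rewrite -setI_eq0 => /eqP->; rewrite cards0.
have RP : R \subset porbits s by apply/subsetP => C /Rpoor[].
have UR : unhit I \subset R.
  by apply/subsetP => C CU; rewrite inE; apply/exists_inP; exists C; rewrite ?connect0.
pose V := [set t in [set: T] | porbit s t \in R].
have cardV : #|V| = \sum_(C in R) #|C|.
  by rewrite card_in_porbits //; apply: eq_bigr => C _; rewrite setIT.
have cardVk : #|V| <= 4 * #|k @: V|.
  rewrite mulnC -sum_nat_const -sum1_card (partition_big k (mem (k @: V))) /=; last first.
    by move=> t tV; apply: imset_f.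
  apply: leq_sum => j _; rewrite sum1_card -(fibre4 j); apply: subset_leq_card.
  by apply/subsetP => t; rewrite !inE => /andP[].
have cardk : #|k @: V| <= #|[set t in I | porbit s t \in R]|.
  apply: leq_trans (leq_imset_card k _); apply: subset_leq_card.
  apply/subsetP => j /imsetP[r rV ->]; have rR : porbit s r \in R by move: rV; rewrite !inE.
  have /transversalP[ex _ _ _] := It; have [i iI kir] := ex (k r) (in_setT _).
  apply/imsetP; exists i; rewrite // inE iI.
  move: rR; rewrite !inE => /exists_inP[C0 C0U c0].
  apply/exists_inP; exists C0 => //; apply: connect_trans c0 (connect1 _).
  rewrite /step !imset_f //=; apply/exists_inP; exists r; first exact: porbit_id.
  by apply/exists_inP; exists i; rewrite ?inE ?iI ?porbit_id ?kir.
rewrite card_in_porbits // in cardk.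
have sumI : \sum_(C in R) #|C :&: I| + #|unhit I| <= #|R|.
  rewrite -[#|unhit I|](_ : \sum_(C in R) (C \in unhit I) = _); last first.
    rewrite -sum1_card big_mkcond [RHS]big_mkcond; apply: eq_bigr => C _.
    by case CU: (C \in unhit I); [rewrite (subsetP UR _ CU)|case: ifP].
  rewrite -big_split -sum1_card; apply: leq_sum => C /Rpoor[_ _].
  by case: (C \in unhit I) => /=; rewrite ?addn1 ?addn0.
have sum3 : 4 * #|R| <= \sum_(C in R) #|C| + #|[set C in porbits s | #|C| == 3]|.
  apply: (@leq_trans (\sum_(C in R) #|C| + \sum_(C in R) (#|C| == 3))); last first.
    rewrite leq_add2l -sum1_card big_mkcond [leqRHS]big_mkcond; apply: leq_sum => C _.
    by rewrite inE; case: ifP => // CR; rewrite (subsetP RP _ CR); case: eqP.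
  rewrite -big_split mulnC -sum_nat_const; apply: leq_sum => C /Rpoor[_ l3 _] /=.
  by case: eqP => [->//|/eqP n3]; rewrite addn0 ltn_neqAle eq_sym n3.
rewrite cardV in cardVk; move: cardVk cardk sumI sum3.
move: (\sum_(C in R) #|C|) (\sum_(C in R) #|C :&: I|) => a b.
move: #|unhit I| #|R| #|k @: V| #|[set C in porbits s | _]| => c d e f; lia.
Qed.
End Exchange.

(** * Cycles cut open and laid in a row *)

Section CyclesInARow.
Variables (T : finType) (s : {perm T}) (root : {set T} -> T).
Hypothesis root_in : forall C, C \in porbits s -> root C \in C.

Definition row : seq T := flatten [seq traject s (root C) #|C| | C <- enum (porbits s)].

Lemma traject_root C : C \in porbits s -> traject s (root C) #|C| =i C.
Proof.
move=> CP t; have: porbit s (root C) == C by rewrite -porbits_eq ?root_in.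
by move: (root C) => r /eqP <-; rewrite porbit_traject.
Qed.

Lemma mem_row t : t \in row.
Proof.
apply/flattenP; exists (traject s (root (porbit s t)) #|porbit s t|).
  by apply/mapP; exists (porbit s t); rewrite ?mem_enum ?imset_f.
by rewrite traject_root ?imset_f ?porbit_id.
Qed.

Lemma uniq_row : uniq row.
Proof.
apply: (leq_size_uniq (enum_uniq T)) => [t _|]; first exact: mem_row.
rewrite -cardE size_flatten /shape -map_comp sumnE big_map.
rewrite (eq_bigr (fun C : {set T} => #|C :&: setT|)); last first.
  by move=> C _; rewrite /= size_traject setIT.
rewrite big_enum -(@card_in_porbits _ s) // -[#|T|]cardsT.
by apply: subset_leq_card; apply: subsetT.
Qed.

(** Each cycle is listed from its root, so only the edge that returns to the root is cut. *)
Lemma row_split t : s t != root (porbit s t) ->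
  exists a b, row = a ++ t :: s t :: b.
Proof.
set C := porbit s t => st; have CP : C \in porbits s by exact: imset_f.
have : C \in enum (porbits s) by rewrite mem_enum.
rewrite /row; case/splitPr => c1 c2; rewrite map_cat flatten_cat /=.
have : t \in traject s (root C) #|C| by rewrite traject_root // porbit_id.
case/trajectP => i iC tE.
have i1C : i.+1 < #|C|.
  rewrite ltn_neqAle iC andbT; apply: contraNneq st => i1.
  have RE : porbit s (root C) = C by apply/eqP; rewrite -porbits_eq ?root_in.
  by have := iter_porbit s (root C); rewrite RE tE -iterS i1 => ->.
rewrite -(subnKC i1C) -[i.+2]addn2 -addnA trajectD -tE /=.
by do 2 eexists; rewrite -catA /= catA; congr (_ ++ _).
Qed.
End CyclesInARow.

Section FromTransversal.
Variables (T : finType) (s : {perm T}) (q : nat) (k : T -> 'I_q).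
Hypothesis fibre4 : forall j, #|[set t | k t == j]| = 4.

(** [I] receives the colour [None]. Removing it from [row] leaves a path with three vertices in each
    fibre, to which [path_triangles] applies. *)
Lemma colour_but_unhit : T ->
  exists (Z : {set T}) (c : T -> option 'I_3),
    4 * #|Z| <= #|[set C in porbits s | #|C| == 3]| /\
    forall t u, t \notin Z -> u \notin Z -> t != u -> k t = k u \/ u = s t -> c t != c u.
Proof.
move=> t0; have [I It Ile] := few_unhit s fibre4.
have /transversalP[ex uni _ ind] := It.
(* A root in [I] whenever possible: the cut edge of a cycle that [I] meets then ends in [I]. *)
pose root (C : {set T}) : T := odflt (odflt t0 [pick t in C]) [pick t in C :&: I].
have root_in C : C \in porbits s -> root C \in C.
  case/imsetP=> t _ ->; rewrite /root; set P := porbit s t.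
  case: (pickP (mem (P :&: I))) => [u|_] /=; first by rewrite inE => /andP[].
  by case: (pickP (mem P)) => [u|/(_ t)] //=; rewrite porbit_id.
have rootI C : root C \notin I -> [disjoint C & I].
  rewrite /root; case: (pickP (mem (C :&: I))) => [u|H _] /=; first by rewrite inE => /andP[_ ->].
  by rewrite -setI_eq0; apply/eqP/setP => u; rewrite in_set0; exact: H.
pose Z := root @: unhit s I.
pose W := [seq t <- row s root | t \notin I].
have uW : uniq W by rewrite filter_uniq // uniq_row.
have memW t : (t \in W) = (t \notin I) by rewrite mem_filter mem_row ?andbT.
pose P (i : 'I_(size W)) := k (nth t0 W i).
have cardP j : #|[set i | P i == j]| = 3.
  have /card_gt0P : 0 < #|[set t | k t == j]| by rewrite fibre4.
  have [t tI kt] := ex j (in_setT _); move=> _.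
  have -> : #|[set i | P i == j]| = #|[set u | k u == j] :\ t|.
    rewrite -(card_in_imset (f := fun i : 'I_(size W) => nth t0 W i)); last first.
      move=> a b _ _ /eqP; rewrite nth_uniq // => /eqP; exact: val_inj.
    apply: eq_card => u; rewrite !inE; apply/imsetP/andP => [[i]|[ut /eqP ku]].
      rewrite inE => /eqP iP ->; split; last by rewrite -iP.
      have : nth t0 W i \in W by rewrite mem_nth.
      by rewrite memW; apply: contraNneq => ->.
    have uW' : u \in W.
      by rewrite memW; apply: contra ut => uI; apply/eqP/uni; rewrite // ku.
    have iW : index u W < size W by rewrite index_mem.
    exists (Ordinal iW); rewrite /= ?nth_index //.
    by rewrite inE /P /= nth_index // ku.
  by have := fibre4 j; rewrite (cardsD1 t) inE kt eqxx => -[].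
have [col [colS colP]] := path_triangles cardP.
pose c t := omap col (insub (index t W)).
have cN t : t \notin I -> exists2 i : 'I_(size W), c t = Some (col i) & t = nth t0 W i.
  rewrite -memW => tW; have iW : index t W < size W by rewrite index_mem.
  by exists (Ordinal iW); rewrite /= ?nth_index // /c (insubT (fun n => n < size W) iW).
have cI t : t \in I -> c t = None.
  by move=> tI; rewrite /c insubF // index_mem memW tI.
have consec t : t \notin I -> s t \notin I -> s t != root (porbit s t) -> c t != c (s t).
  move=> tI sI /(row_split root_in)[a [b E]].
  have [i -> iE] := cN t tI; have [j -> jE] := cN (s t) sI.
  suff ij : j = i.+1 :> nat by have := colS i j ij; apply: contra => /eqP[->].
  have WE : W = [seq t <- a | t \notin I] ++ t :: s t :: [seq t <- b | t \notin I].
    by rewrite /W E filter_cat /= tI sI.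
  set a' := filter _ a in WE.
  have ia : index t W = size a'.
    move: uW; rewrite WE index_cat cat_uniq => /and3P[_ /hasPn/(_ t (mem_head _ _)) /negPf /= -> _].
    by rewrite eqxx addn0.
  have ja : index (s t) W = (size a').+1.
    move: uW; rewrite WE index_cat cat_uniq => /and3P[_ /hasPn H /= /andP[tN _]].
    have /negPf /= -> := H (s t) (mem_behead (s := [:: t, s t & _]) (mem_head _ _)).
    rewrite eqxx; case: eqP => [E2|_]; last by rewrite addn1.
    by move: tN; rewrite inE -E2 eqxx.
  by rewrite jE iE !index_uniq // in ia ja; rewrite ia ja.
exists Z, c; split.
  by apply: leq_trans Ile; rewrite leq_mul2l leq_imset_card orbT.
move=> t u tZ uZ tu.
case: (boolP (t \in I)) => tI; case: (boolP (u \in I)) => uI.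
- case=> [kE|us]; first by rewrite (uni _ _ tI uI kE) eqxx in tu.
  by have := ind t u tI uI; rewrite /cycle_adj tu us eqxx.
- by rewrite (cI t) //; have [i ->] := cN u uI.
- by rewrite (cI u) //; have [i ->] := cN t tI.
case=> [kE|us].
  have [i -> iE] := cN t tI; have [j -> jE] := cN u uI.
  have ij : i != j by apply: contraNneq tu => ij; rewrite iE jE ij.
  by have := colP i j ij; rewrite /P -iE -jE => /(_ kE); apply: contra => /eqP[->].
(* If the cut edge avoids [I], the cycle misses [I]; its root is in [Z] unless its length is at most
   2, and then the edge is present in the other direction, from [s t] to [t]. *)
rewrite us in uZ tu uI *; have [sr|sr] := eqVneq (s t) (root (porbit s t)); last exact: consec.
have CP : porbit s t \in porbits s by exact: imset_f.
have l2 : #|porbit s t| <= 2.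
  rewrite leqNgt; apply: contra uZ => l2; apply/imsetP; exists (porbit s t); rewrite // inE CP l2 /=.
  by apply: rootI; rewrite -sr.
have sst : s (s t) = t.
  have := iter_porbit s t; have : 0 < #|porbit s t| by apply/card_gt0P; exists t; exact: porbit_id.
  case: #|porbit s t| l2 => [|[|[|]]] //= _ _ E; by rewrite !E.
have E := porbit_perm s t.
rewrite eq_sym -{2}sst; apply: consec; rewrite ?sst // E -sr //.
Qed.
End FromTransversal.

(** * Reduction to permutations *)

Section DegreeTwo.
Variables (T : finType) (e : rel T).
Hypotheses (e_sym : symmetric e) (e_irr : irreflexive e).
Hypothesis deg2 : forall x, #|[set y | e x y]| <= 2.

Lemma two_neighbours u a b v : e u a -> e u b -> a != b -> e u v -> v = a \/ v = b.
Proof.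
move=> ua ub ab uv; case: (v =P a) => [|/eqP va]; first by left.
case: (v =P b) => [|/eqP vb]; first by right.
have : #|[set v; a; b]| <= 2.
  apply: leq_trans (deg2 u); apply/subset_leq_card/subsetP => z.
  by rewrite !inE => /orP[/orP[]|] /eqP->.
by rewrite -setUA cardsU1 cards2 ab !inE (negPf va) (negPf vb).
Qed.

(** Maximality keeps the neighbours of both ends on the path, and interior vertices already have
    their two neighbours; the one possible extra edge joins the two ends, and [next] wraps around to
    include it. *)
Lemma longest_path_closed (S : {set T}) x w :
  path e x w -> uniq (x :: w) ->
  (forall y v, path e y v -> uniq (y :: v) -> y \in S -> size v <= size w) ->
  (forall y z, y \in S -> e y z -> z \in S) -> x \in S ->
  forall u v, u \in x :: w -> e u v ->
    v \in x :: w /\ (v = next (x :: w) u \/ u = next (x :: w) v).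
Proof.
move=> pw uw wmax Scl xS; set c := x :: w; pose C i := nth x c i.
have sz : size c = (size w).+1 by [].
have eC i : i < size w -> e (C i) (C i.+1) by move/(pathP x pw).
have inC i : i <= size w -> C i \in c by move=> iw; rewrite mem_nth.
have nextC i : i <= size w -> next c (C i) = C i.+1.
  by move=> iw; rewrite next_nth inC // {1}/c index_uniq // sz ltnS.
(* The default value [x] of [nth] makes [C] wrap around. *)
have Clast : C (size w).+1 = C 0 by rewrite /C nth_default.
have interior i v : 0 < i < size w -> e (C i) v -> v = C i.-1 \/ v = C i.+1.
  case: i => // i /= iw; apply: two_neighbours; rewrite ?eC //.
    by rewrite e_sym eC // ltnW.
  by rewrite nth_uniq ?sz // ?ltnS ?(ltnW (ltnW iw)) // ?ltnW //; lia.
have CP u : u \in c -> exists2 i, i <= size w & u = C i.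
  by move=> uc; exists (index u c); rewrite /C ?nth_index // -ltnS -sz index_mem.
move=> u v /CP[i iw ->] uv; have vc : v \in c.
  case: (posnP i) => [i0|i0].
    rewrite i0 in uv; apply: contraT => vc; have vx : e v x by rewrite e_sym.
    have pv : path e v c by rewrite /= vx.
    have Uv : uniq (v :: c) by rewrite cons_uniq vc.
    by have := wmax v c pv Uv (Scl _ _ xS uv); rewrite ltnn.
  move: iw; rewrite leq_eqVlt => /orP[/eqP iE|iw]; last first.
    by have [||] := interior i v _ uv; [rewrite i0|move->; apply: inC; lia|move->; apply: inC].
  rewrite iE in uv; apply: contraT => vc.
  have lastC : C (size w) = last x w by rewrite /C -[size w]/((size c).-1) nth_last.
  have pr : path e x (rcons w v) by rewrite rcons_path pw -lastC.
  have Ur : uniq (x :: rcons w v) by rewrite -rcons_cons rcons_uniq vc.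
  by have := wmax x _ pr Ur xS; rewrite size_rcons ltnn.
split=> //; case: (boolP (0 < i < size w)) => [ii|ii].
  by have [->|->] := interior i v ii uv; [right|left]; rewrite nextC ?prednK //; lia.
have [j jw vE] := CP v vc; rewrite vE in uv *.
case: (boolP (0 < j < size w)) => [jj|jj].
  rewrite e_sym in uv.
  by have [->|->] := interior j _ jj uv; [left|right]; rewrite nextC ?prednK //; lia.
rewrite !nextC //.
have [i0|in_] : i = 0 \/ i = size w by lia.
  have [j0|jn] : j = 0 \/ j = size w by lia.
    by rewrite i0 j0 e_irr in uv.
  by right; rewrite i0 jn Clast.
have [j0|jn] : j = 0 \/ j = size w by lia.
  by left; rewrite in_ j0 Clast.
by rewrite in_ jn e_irr in uv.
Qed.

(** The vertices of a longest path in [S] form a component; [next] serves there, and induction on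
    the rest. *)
Lemma degree2_closed n (S : {set T}) : #|S| <= n ->
  (forall y z, y \in S -> e y z -> z \in S) ->
  exists f : T -> T, [/\ {in S, forall x, f x \in S}, {in S &, injective f}
    & forall x y, x \in S -> e x y -> y = f x \/ x = f y].
Proof.
elim: n S => [|n IH] S cS Scl.
  by exists id; split=> // x y; move: cS; rewrite leqn0 cards_eq0 => /eqP->; rewrite inE.
case: (set_0Vmem S) => [S0|[x0 x0S]].
  by exists id; split=> // x y; rewrite S0 inE.
pose P m := [exists x in S, exists w : m.-tuple T, path e x w && uniq (x :: w)].
have P0 : exists m, P m.
  by exists 0; apply/exists_inP; exists x0 => //; apply/existsP; exists [tuple].
have Pb m : P m -> m <= #|T|.
  case/exists_inP=> x _ /existsP[w /andP[_ uw]].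
  by apply: leq_trans (max_card (mem (x :: w))); rewrite (card_uniqP uw) /= size_tuple.
case: (ex_maxnP P0 Pb) => m /exists_inP[x xS /existsP[w /andP[pw uw]]] mmax.
have closed := @longest_path_closed S x w pw uw _ Scl xS.
set c := x :: w in uw closed.
have {}closed : forall u v, u \in c -> e u v -> v \in c /\ (v = next c u \/ u = next c v).
  apply: closed => y v pv uv yS; rewrite size_tuple; apply: mmax.
  by apply/exists_inP; exists y => //; apply/existsP; exists (in_tuple v); rewrite pv.
have cS' u : u \in c -> u \in S.
  have H (v : seq T) z y : z \in S -> path e z v -> y \in v -> y \in S.
    elim: v z => //= z' v IHv z zS /andP[zz' pv].
    have z'S : z' \in S := Scl z z' zS zz'.
    by rewrite inE => /orP[/eqP->//|]; exact: IHv z' z'S pv.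
  by rewrite inE => /orP[/eqP->//|]; exact: H xS pw.
have [||f [f1 f2 f3]] := IH (S :\: [set u in c]).
- rewrite -ltnS; apply: leq_trans cS; apply: proper_card; apply/properP; split.
    exact: subsetDl.
  by exists x; rewrite // !inE eqxx.
- move=> y z; rewrite !inE => /andP[yc yS] yz; rewrite (Scl y z) // andbT.
  by apply: contra yc => zc; have [] := closed z y zc; rewrite // e_sym.
pose D := S :\: [set u in c]; have inD u : (u \in D) = (u \notin c) && (u \in S) by rewrite !inE.
exists (fun u => if u \in c then next c u else f u); split.
- move=> u uS; case: ifP => uc; first by apply: cS'; rewrite mem_next.
  by have := f1 u; rewrite -/D !inD uc uS => /(_ isT)/andP[].
- move=> u v uS vS; case: ifP => uc; case: ifP => vc.
  + by move/(can_inj (prev_next uw)).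
  + move=> E; have := f1 v; rewrite -/D !inD vc vS -E mem_next uc => /(_ isT) //.
  + move=> E; have := f1 u; rewrite -/D !inD uc uS E mem_next vc => /(_ isT) //.
  by apply: f2; rewrite -/D inD ?uc ?vc.
move=> u v uS uv; case: ifP => uc.
  by have [-> [->|E]] := closed u v uc uv; [left|right].
case: ifP => vc; first by have [] := closed v u vc; rewrite 1?e_sym // uc.
by apply: f3; rewrite // -/D inD uc.
Qed.

Lemma degree2_perm : exists s : {perm T}, forall x y, e x y -> y = s x \/ x = s y.
Proof.
have [|//|f [_ fI fe]] := @degree2_closed #|T| setT; first exact: max_card.
have fI' : injective f by move=> x y; apply: fI; rewrite inE.
by exists (perm fI') => x y /fe; rewrite !permE; apply; rewrite inE.
Qed.
End DegreeTwo.

(** * Combining the two deletion sets *)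

Lemma four_colour_core (T : finType) (s : {perm T}) (q : nat) (k : T -> 'I_q) : T ->
  (forall j, #|[set t | k t == j]| = 4) ->
  exists (Z : {set T}) (c : T -> 'I_4), 22 * #|Z| <= #|T| /\
    forall t u, t \notin Z -> u \notin Z -> t != u -> k t = k u \/ u = s t -> c t != c u.
Proof.
move=> t0 fibre4.
have le : \sum_(C | long_odd s C) #|C| + 3 * #|[set C in porbits s | #|C| == 3]| <= #|T|.
  rewrite -[#|T|]cardsT -(_ : #|[set t in setT | porbit s t \in porbits s]| = #|[set: T]|).
    rewrite card_in_porbits // mulnC -sum_nat_const big_mkcond.
    rewrite [X in _ + X]big_mkcond [leqRHS]big_mkcond -big_split; apply: leq_sum => C _.
    rewrite inE /long_odd setIT /=; case: (C \in porbits s) => //=.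
    by case: eqP => [->//|_]; rewrite addn0; case: ifP.
  by apply: eq_card => t; rewrite !inE imset_f.
have [Z1 [c1 [Z1le c1P]]] := colour_but_few s t0 fibre4.
have [Z2 [c2 [Z2le c2P]]] := colour_but_unhit s fibre4 t0.
(* Let [n = #|T|], [a] the total long odd length and [t] the number of triangles. If
   [22 * #|Z1| > n], then [a > 10 n / 22], so [3 t <= n - a < 12 n / 22] and
   [4 * #|Z2| <= t < 4 n / 22]. *)
have [l22|l22] := leqP (22 * #|Z1|) #|T|.
  have b4 : #|{: bool * bool}| = 4 by rewrite card_prod card_bool.
  exists Z1, (fun t => cast_ord b4 (enum_rank (c1 t))).
  by split=> // t u tZ uZ tu H; rewrite (inj_eq (@cast_ord_inj _ _ _)) (inj_eq enum_rank_inj) c1P.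
have c4 : #|{: option 'I_3}| = 4 by rewrite card_option card_ord.
exists Z2, (fun t => cast_ord c4 (enum_rank (c2 t))); split; last first.
  by move=> t u tZ uZ tu H; rewrite (inj_eq (@cast_ord_inj _ _ _)) (inj_eq enum_rank_inj) c2P.
move: le Z1le Z2le l22; move: (\sum_(C | _) _) #|[set C in _ | _]| #|T| #|Z1| #|Z2| => a b n z1 z2.
lia.
Qed.

(** Greedy: a vertex with at most two neighbours always finds one of four colours free. *)
Lemma colorable_extend (T : finType) (g : rel T) (A B : {set T}) :
  symmetric g -> irreflexive g -> (forall x, x \in B -> #|[set y | g x y]| <= 2) ->
  colorable_on g A 4 -> colorable_on g (A :|: B) 4.
Proof.
move=> g_sym g_irr degB; elim: {B}#|B| {-2}B (leqnn #|B|) degB => [|n IH] B.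
  by rewrite leqn0 cards_eq0 => /eqP-> _; rewrite setU0.
move=> cB degB colA; case: (set_0Vmem B) => [->|[b bB]]; first by rewrite setU0.
have [||c cP] := IH (B :\ b) _ _ colA.
- by move: cB; rewrite (cardsD1 b) bB.
- by move=> x; rewrite !inE => /andP[_]; exact: degB.
have [a aN] : exists a, a \notin c @: [set y | g b y].
  apply/existsP; rewrite -negb_forall; apply/negP => /forallP all.
  have : #|'I_4| <= #|c @: [set y | g b y]| by apply/subset_leq_card/subsetP => a _; exact: all.
  by have := leq_imset_card c [set y | g b y]; have := degB b bB; rewrite card_ord; lia.
have aP y : g b y -> a != c y.
  by move=> by_; apply: contraNneq aN => ->; apply: imset_f; rewrite inE.
exists (fun x => if x == b then a else c x) => x y xA yA xy.
have inAB z : z != b -> z \in A :|: B -> z \in A :|: B :\ b.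
  by rewrite !inE => ->.
case: (x =P b) => [xb|/eqP xb]; case: (y =P b) => [yb|/eqP yb].
- by rewrite xb yb g_irr in xy.
- by rewrite aP // -xb.
- by rewrite eq_sym aP // -yb g_sym.
by apply: cP; rewrite // inAB.
Qed.

Theorem theorem1p3 (T : finType) (h : rel T) (q : nat) (Y : 'I_q -> {set T}) :
  simple_graph h ->
  max_deg_le h 2 ->
  (forall j, #|Y j| = 4) ->
  (forall i j, i != j -> [disjoint Y i & Y j]) ->
  exists Z : {set T},
    22 * #|Z| <= #|T| /\ colorable_on (glue_cliques h Y) (~: Z) 4.
Proof.
move=> [h_irr h_sym] deg2 Y4 Ydis.
pose S := [set x | [exists j, x \in Y j]].
pose g := glue_cliques h Y.
have g_irr : irreflexive g by move=> x; rewrite /g /glue_cliques h_irr eqxx.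
have g_sym : symmetric g.
  move=> x y; rewrite /g /glue_cliques h_sym eq_sym; congr (_ || (_ && _)).
  by apply: eq_existsb => j; rewrite andbC.
have gN x y : x \notin S -> g x y = h x y.
  rewrite inE negb_exists => /forallP xS; rewrite /g /glue_cliques.
  case: existsP => [[j]|]; last by rewrite andbF orbF.
  by rewrite (negPf (xS j)).
have extend (Z : {set T}) : colorable_on g (S :\: Z) 4 -> colorable_on g (~: Z) 4.
  move/(@colorable_extend _ _ _ (~: S)) => [||x xS|c cP] //.
    apply: leq_trans (deg2 x); apply: subset_leq_card; apply/subsetP => y.
    by rewrite !inE gN // -in_setC.
  have inU z : z \in ~: Z -> z \in S :\: Z :|: ~: S.
    by rewrite in_setU in_setD !in_setC => ->; exact: orbN.
  by exists c => x y xZ yZ; apply: cP; exact: inU.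
(* On the glued vertices alone the fibres of [k] are the sets [Y j], all of size 4, and [h] still
   has maximum degree at most 2. *)
pose U := {x | x \in S}; have YU (u : U) : exists j, val u \in Y j.
  by apply/existsP; have := valP u; rewrite inE.
pose k (u : U) := xchoose (YU u).
have kP (u : U) j : (k u == j) = (val u \in Y j).
  apply/eqP/idP => [<-|uj]; first exact: (xchooseP (YU u)).
  apply/eqP; apply: contraT => /Ydis dis.
  by rewrite (disjointFr dis (xchooseP (YU u))) in uj.
have fibre4 j : #|[set u | k u == j]| = 4.
  rewrite -(Y4 j) -(card_imset _ val_inj); apply: eq_card => x.
  apply/imsetP/idP => [[u]|xj]; first by rewrite inE kP => ? ->.
  have xS : x \in S by rewrite inE; apply/existsP; exists j.
  by exists (Sub x xS); rewrite // inE kP.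
case: (pickP (mem [set: U])) => [u0 _|none]; last first.
  exists set0; split; first by rewrite cards0.
  apply: extend; exists (fun=> ord0) => x y; rewrite inE => /andP[_ xS].
  by have := none (Sub x xS); rewrite !inE.
pose e : rel U := fun u v => h (val u) (val v).
have [||u|s sP] := @degree2_perm U e.
- by move=> u v; exact: h_sym.
- by move=> u; exact: h_irr.
- rewrite -(card_imset _ val_inj); apply: leq_trans (deg2 (val u)).
  by apply/subset_leq_card/subsetP => x /imsetP[v]; rewrite !inE => uv ->.
have [Z [c [Zle cP]]] := four_colour_core s u0 fibre4.
exists [set val u | u in Z]; split.
  rewrite card_imset; last exact: val_inj.
  by apply: leq_trans Zle _; rewrite card_sub; exact: max_card.
apply: extend; exists (fun x => if insub x is Some u then c u else ord0) => x y.
rewrite !in_setD => /andP[xZ xS] /andP[yZ yS] xy.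
rewrite (insubT (mem S) xS) (insubT (mem S) yS).
set u : U := Sub x xS; set v : U := Sub y yS.
have uZ : u \notin Z by apply: contra xZ => uZ; apply/imsetP; exists u.
have vZ : v \notin Z by apply: contra yZ => vZ; apply/imsetP; exists v.
have uv : u != v by apply: contraTneq xy => /(congr1 val) /= ->; rewrite g_irr.
case/orP: xy => [/(sP u v)[E|E]|/andP[_ /existsP[j /andP[xj yj]]]].
- by apply: cP => //; right.
- by rewrite eq_sym; apply: cP; rewrite 1?eq_sym //; right.
apply: cP => //; left; transitivity j; last apply/esym; apply/eqP; by rewrite kP.
Qed.
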